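(* Let $\mathcal{P}$ be a finite atomic poset with set of minimal elements $A$, let $M(\mathcal{P})$ be the subposet of $\Sigma(A)$ meet-generated by $\mathcal{P}$ in $\Sigma(A)$, and let $\Bbbk$ be a field. Then $\mathcal{P}$ is (isomorphic to) the Betti poset of a monomial ideal over $\Bbbk$ if and only if an element $x\in M(\mathcal{P})\setminus\hat0$ is not in $\mathcal{P}$ precisely when $$\widetilde{H}_n\bigl(\Delta(M(\mathcal{P})_{<x}\setminus\hat0);\Bbbk\bigr)=0\quad\text{for all }n.$$
   Context: For a finite poset $\mathcal{P}$ and $x\in\mathcal{P}$, $A_x$ is the set of all minimal elements of $\mathcal{P}$ that are $\le x$. $\mathcal{P}$ is called atomic if each $x\in\mathcal{P}$ is the join (unique least upper bound) in $\mathcal{P}$ of the elements of $A_x$. Let $A$ be the set of minimal elements of $\mathcal{P}$ and $\Sigma(A)$ the Boolean lattice of all subsets of $A$ ordered by inclusion. An atomic poset $\mathcal{P}$ is regarded as a subposet of $\Sigma(A)$ via the embedding $\sigma(x)=A_x$. $M(\mathcal{P})$ is the subposet of $\Sigma(A)$ whose elements are all meets in $\Sigma(A)$ (i.e. intersections) of subsets of $\mathcal{P}$; the meet of the empty subset is $A$. It is a finite lattice, and $\hat0$ denotes its minimal element. $M(\mathcal{P})_{<x}=\{y\in M(\mathcal{P})\mid y<x\}$. The order complex $\Delta(\mathcal{Q})$ of a poset $\mathcal{Q}$ is the simplicial complex whose $n$-faces are the strictly increasing chains $a_0<\dots<a_n$ in $\mathcal{Q}$. $\widetilde{H}_n(-;\Bbbk)$,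 $n\ge-1$, is reduced simplicial homology, with $\widetilde{H}_{-1}(\Delta(\emptyset);\Bbbk)=\Bbbk$. A monomial ideal over $\Bbbk$ is a monomial ideal $I$ of some polynomial ring $R=\Bbbk[x_1,\dots,x_m]$ with its standard $\mathbb{Z}^m$-grading. Its Betti poset over $\Bbbk$ is $\mathcal{B}(I,\Bbbk)=\{\alpha\in\mathbb{Z}^m\mid\operatorname{Tor}^R_d(I,R/(x_1,\dots,x_m))_\alpha\ne0\text{ for some }d\}$ (the set of degrees of homogeneous basis elements of the free modules in the minimal free multigraded resolution of $I$), ordered by the coordinatewise order of $\mathbb{Z}^m$. *)

(* Defs.v *)
From mathcomp Require Import all_boot all_order all_algebra.
From mathcomp Require Import mpoly.

Set Implicit Arguments.
Unset Strict Implicit.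
Unset Printing Implicit Defensive.

Import Order.TTheory GRing.Theory Num.Theory.
Local Open Scope ring_scope.

Section AtomicPosets.
Context {d : Order.disp_t} (P : finPOrderType d).

Definition min_elts : {set P} :=
  [set a | [forall y : P, (y <= a)%O ==> (y == a)]].

Definition atoms_below (x : P) : {set P} := [set a in min_elts | (a <= x)%O].

Definition is_join (S : {set P}) (x : P) : Prop :=
  (forall a, a \in S -> (a <= x)%O) /\
  (forall y, (forall a, a \in S -> (a <= y)%O) -> (x <= y)%O).

Definition atomic : Prop := forall x : P, is_join (atoms_below x) x.

(* The image of the embedding of P into the lattice of subsets of min_elts. *)
Definition sigma_image : {set {set P}} := [set atoms_below x | x : P].

(* The intersection with min_elts only matters for S = set0, whose meet is the
   top element min_elts (and not [set: P]). *)
Definition meets : {set {set P}} :=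
  [set min_elts :&: \bigcap_(x in S) atoms_below x | S : {set P}].

Definition hat0 : {set P} := \bigcap_(B in meets) B.

Definition punctured_below (x : {set P}) : {set {set P}} :=
  [set y in meets | (y \proper x) && (y != hat0)].

(* Since meets is closed under intersection, hat0 really is its least element. *)
Lemma hat0_least :
  hat0 \in meets /\ (forall B, B \in meets -> hat0 \subset B).
Proof.
split; last by move=> B BM; apply: bigcap_inf.
apply/imsetP; exists [set: P] => //; apply/eqP; rewrite eqEsubset.
apply/andP; split; first by apply: bigcap_inf; apply: imset_f.
apply/bigcapsP => B /imsetP [S _ ->]; apply: setIS.
by apply/bigcapsP => x xS; apply: bigcap_inf.
Qed.

End AtomicPosets.

(* Reduced homology of the order complex of a finite poset Q, given as a subset
   of a finite type T with strict order lt.  Everything is indexed by the number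
   n of vertices of a face, i.e. one plus its dimension, so that n = 0 is the
   empty face, of dimension -1. *)
Section OrderComplex.
Variables (k : fieldType) (T : finType) (lt : rel T) (Q : {set T}).

Definition chain_pred n (s : n.-tuple T) : bool :=
  sorted lt s && all (fun y => y \in Q) s.

Definition face n := {s : n.-tuple T | chain_pred s}.

Definition del_vertex n (i : 'I_n.+1) (s : n.+1.-tuple T) : n.-tuple T :=
  [tuple tnth s (lift i j) | j < n].

Definition schain n := {ffun face n -> k}.

Definition sboundary n (c : schain n.+1) : schain n :=
  [ffun t => \sum_(s : face n.+1)
     \sum_(i < n.+1 | del_vertex i (val s) == val t) (-1) ^+ i * c s].

Definition scycle n : schain n -> Prop :=
  match n with
  | 0 => fun=> True
  | n'.+1 => fun c => sboundary c = 0
  end.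

(* Homology in dimension n - 1 is zero. *)
Definition reduced_homology_zero n : Prop :=
  forall c : schain n, scycle c -> exists b : schain n.+1, c = sboundary b.

End OrderComplex.

Section BettiPoset.
Variables (k : fieldType) (m : nat).

Notation R := {mpoly k[m]}.
Notation Zm := {ffun 'I_m -> int}.

Definition monomial_ideal (I : R -> Prop) : Prop :=
  exists G : 'X_{1..m} -> Prop, forall p : R,
    I p <-> exists s : seq (R * 'X_{1..m}),
              (forall u, u \in s -> G u.2) /\ p = \sum_(u <- s) u.1 * 'X_[u.2].

(* The element 0 is homogeneous of every degree. *)
Definition homogeneous (a : Zm) (p : R) : Prop :=
  forall e : 'X_{1..m}, e \in msupp p -> forall i : 'I_m, (e i)%:Z = a i.

(* Z^m-graded free modules F_n = \bigoplus_j R(- gdeg j) of finite rank, with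
   R-linear maps F_{n+1} -> F_n and F_0 -> R.  Matrices act on row vectors on
   the right: row j is the image of the j-th basis element. *)
Record free_complex := FreeComplex {
  grank : nat -> nat;
  gdeg : forall n, 'I_(grank n) -> Zm;
  gdiff : forall n, 'M[R]_(grank n.+1, grank n);
  gaug : 'cV[R]_(grank 0)
}.

Definition multigraded (F : free_complex) : Prop :=
  (forall n (i : 'I_(grank F n.+1)) (j : 'I_(grank F n)),
     homogeneous (gdeg i - gdeg j) (gdiff F n i j)) /\
  (forall j : 'I_(grank F 0), homogeneous (gdeg j) (gaug F j 0)).

(* Exactness of ... -> F_1 -> F_0 -> I -> 0. *)
Definition resolves (F : free_complex) (I : R -> Prop) : Prop :=
  [/\ forall n (v : 'rV[R]_(grank F n.+1)),
        v *m gdiff F n = 0 <-> exists w, v = w *m gdiff F n.+1,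
      forall v : 'rV[R]_(grank F 0),
        v *m gaug F = 0 <-> exists w, v = w *m gdiff F 0
    & forall p : R, I p <-> exists v : 'rV[R]_(grank F 0), v *m gaug F = p%:M].

(* The complex F tensored with R/(x_1,...,x_m), which is k via the constant
   coefficient. *)
Definition tdiff (F : free_complex) n : 'M[k]_(grank F n.+1, grank F n) :=
  map_mx (mcoeff 0%MM) (gdiff F n).

Definition in_degree (F : free_complex) n (a : Zm) (v : 'rV[k]_(grank F n)) :=
  forall j, v 0 j != 0 -> gdeg j = a.

Definition tcycle (F : free_complex) n : 'rV[k]_(grank F n) -> Prop :=
  match n with
  | 0 => fun=> True
  | n'.+1 => fun v => v *m tdiff F n' = 0
  end.

Definition tensor_homology_zero (F : free_complex) n (a : Zm) : Prop :=
  forall v : 'rV[k]_(grank F n), in_degree a v -> tcycle v ->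
    exists w : 'rV[k]_(grank F n.+1), in_degree a w /\ v = w *m tdiff F n.

(* Tor_n(I, R/(x_1,...,x_m)) in degree a, computed from a multigraded free
   resolution of I; it does not depend on the resolution, and a resolution by
   modules of finite rank exists because R is Noetherian. *)
Definition tor_nonzero (I : R -> Prop) n (a : Zm) : Prop :=
  exists F : free_complex,
    [/\ multigraded F, resolves F I & ~ tensor_homology_zero F n a].

Definition in_betti_poset (I : R -> Prop) (a : Zm) : Prop :=
  exists n, tor_nonzero I n a.

(* f is an order isomorphism of P onto the Betti poset; its injectivity follows
   from the second clause. *)
Definition isomorphic_to_betti_poset {d : Order.disp_t} (P : finPOrderType d)
    (I : R -> Prop) : Prop :=
  exists f : P -> Zm,
    (forall a, in_betti_poset I a <-> exists x, a = f x) /\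
    (forall x y, (x <= y)%O <-> (forall i : 'I_m, f x i <= f y i)).

End BettiPoset.

(* Main.v *)
(** A monomial ideal is resolved by the free modules on the nonempty chains of
    its lcm-lattice without bottom, a chain sitting in the degree of its largest
    element.  Tensoring with the residue field shows that Tor in the degree of
    an lcm [S] is the reduced homology of the open interval below [S], so the
    Betti poset consists of the lcms whose open lower interval is not acyclic.
    Any other resolution computes the same Tor by comparison of resolutions.

    If [P] is the Betti poset of an ideal, the ideal is generated by the
    monomials attached to the atoms, and the nonempty meets form a subposet [N]
    of the lcm-lattice containing [P].  The elements outside [N] have acyclic
    lower intervals, so deleting them does not change the homology of the lower
    intervals, and the criterion for the lcm-lattice becomes the one for [N].
    Conversely, the ideal with one variable per element [p] of [P], where the
    generator of an atom [a] is the product of the variables of all [p] not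
    above [a], has [N] as its lcm-lattice. *)
Require Import Defs.
From HB Require Import structures.
From Stdlib Require Import Classical IndefiniteDescription.
From mathcomp Require Import all_boot all_order all_algebra.
From mathcomp Require Import mpoly zify.

Set Implicit Arguments.
Unset Strict Implicit.
Unset Printing Implicit Defensive.

Import Order.TTheory GRing.Theory Num.Theory.
Local Open Scope ring_scope.

(** * Chains of a finite poset *)

Section PushForward.
Variables (k : fieldType).

Definition push (X Y : finType) (g : X -> Y) (c : {ffun X -> k^o}) :
  {ffun Y -> k^o} := [ffun y => \sum_(x | g x == y) c x].

Lemma push_is_linear (X Y : finType) (g : X -> Y) : linear (push g).
Proof.
move=> a c c'; apply/ffunP => y; rewrite !ffunE scaler_sumr -big_split /=.
by apply: eq_bigr => x _; rewrite !ffunE.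
Qed.

HB.instance Definition _ (X Y : finType) (g : X -> Y) :=
  GRing.isLinear.Build k {ffun X -> k^o} {ffun Y -> k^o} _ (push g)
    (push_is_linear g).

Lemma push_comp (X Y Z : finType) (g : X -> Y) (h : Y -> Z) c :
  push h (push g c) = push (fun x => h (g x)) c.
Proof.
apply/ffunP => z; rewrite !ffunE.
rewrite [RHS](partition_big g (fun y => h y == z)) //=.
apply: eq_bigr => y /eqP hy; rewrite ffunE; apply: eq_bigl => x.
by case: (g x =P y) => [->|_]; rewrite ?hy ?eqxx ?andbF.
Qed.

Lemma eq_push (X Y : finType) (g h : X -> Y) c : g =1 h -> push g c = push h c.
Proof.
by move=> gh; apply/ffunP => y; rewrite !ffunE; apply: eq_bigl => x; rewrite gh.
Qed.

Lemma push_id (X : finType) (c : {ffun X -> k^o}) : push id c = c.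
Proof. by apply/ffunP => y; rewrite ffunE big_pred1_eq. Qed.

Lemma push_supp (X Y : finType) (g : X -> Y) c y :
  push g c y != 0 -> exists2 x, g x = y & c x != 0.
Proof.
rewrite ffunE => nz; case: (pickP (fun x => (g x == y) && (c x != 0))).
  by move=> x /andP [/eqP gx cx]; exists x.
move=> none; case/eqP: nz; apply: big1 => x gx.
by have := none x; rewrite gx /= => /negbFE /eqP.
Qed.

End PushForward.

(** * Boundary and cone operators on tuples of vertices *)

Section OrderedChains.
Variables (k : fieldType) (T : finType).

Notation chain n := {ffun n.-tuple T -> k^o}.

Definition rcons_vertex (z : T) n (t : n.-tuple T) : n.+1.-tuple T :=
  [tuple of rcons t z].

(** Chains are functions on all tuples, repetitions included, so that [bd] and [cone] are total
    linear maps; the order complex is singled out later by the condition [supp]. *)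
Definition bd n (c : chain n.+1) : chain n :=
  \sum_(i < n.+1) (-1) ^+ i *: push (del_vertex i) c.

(** The apex comes last because it will be the largest vertex of a chain; deleting it is then the
    last term of [bd], with sign [(-1) ^+ n]. *)
Definition cone (z : T) n : chain n -> chain n.+1 := push (@rcons_vertex z n).

Definition slice (z : T) n (c : chain n.+1) : chain n :=
  [ffun t => c (rcons_vertex z t)].

Lemma bd_is_linear n : linear (@bd n).
Proof.
move=> a c c'; rewrite /bd scaler_sumr -big_split /=; apply: eq_bigr => i _.
by rewrite linearP scalerDr !scalerA mulrC.
Qed.

HB.instance Definition _ n :=
  GRing.isLinear.Build k (chain n.+1) (chain n) _ (@bd n) (@bd_is_linear n).
HB.instance Definition _ z n := GRing.Linear.on (@cone z n).

Lemma sliceE z n (c : chain n.+1) t : slice z c t = c (rcons_vertex z t).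
Proof. by rewrite ffunE. Qed.

Lemma slice_is_linear z n : linear (@slice z n).
Proof. by move=> a c c'; apply/ffunP => t; rewrite !ffunE. Qed.

HB.instance Definition _ z n :=
  GRing.isLinear.Build k (chain n.+1) (chain n) _ (@slice z n)
    (@slice_is_linear z n).

Lemma tnth_rcons_last z n (t : n.-tuple T) :
  tnth (rcons_vertex z t) ord_max = z.
Proof. by rewrite (tnth_nth z) /= nth_rcons size_tuple ltnn eqxx. Qed.

Lemma tnth_rcons_widen z n (t : n.-tuple T) (i : 'I_n) (j : 'I_n.+1) :
  j = i :> nat -> tnth (rcons_vertex z t) j = tnth t i.
Proof.
by move=> ji; rewrite !(tnth_nth z) /= nth_rcons size_tuple ji ltn_ord.
Qed.

Lemma rcons_vertex_inj z w n (t u : n.-tuple T) :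
  rcons_vertex z t = rcons_vertex w u -> z = w /\ t = u.
Proof.
move=> /(congr1 val) /= /eqP; rewrite eqseq_rcons => /andP [/eqP tu /eqP zw].
by split=> //; apply: val_inj.
Qed.

Lemma rcons_vertexP n (s : n.+1.-tuple T) :
  exists z (t : n.-tuple T), s = rcons_vertex z t.
Proof.
exists (tnth s ord_max), [tuple tnth s (widen_ord (leqnSn n) i) | i < n].
apply: eq_from_tnth => i; case: (unliftP ord_max i) => [j|] ->.
  rewrite (@tnth_rcons_widen _ _ _ j) ?tnth_mktuple; last by rewrite lift_max.
  by congr tnth; apply: val_inj; exact: lift_max.
by rewrite tnth_rcons_last.
Qed.

Lemma del_rcons_max z n (t : n.-tuple T) :
  del_vertex ord_max (rcons_vertex z t) = t.
Proof.
apply: eq_from_tnth => i; rewrite tnth_mktuple; apply: tnth_rcons_widen.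
by rewrite lift_max.
Qed.

Lemma del_rcons_widen z n (t : n.+1.-tuple T) (i : 'I_n.+1) :
  del_vertex (widen_ord (leqnSn n.+1) i) (rcons_vertex z t)
  = rcons_vertex z (del_vertex i t).
Proof.
apply: eq_from_tnth => j; rewrite tnth_mktuple.
case: (unliftP ord_max j) => [l|] ->.
  rewrite (@tnth_rcons_widen _ _ (del_vertex i t) l) ?lift_max //.
  rewrite tnth_mktuple; apply: tnth_rcons_widen.
  exact: (congr1 (bump i) (lift_max l)).
rewrite tnth_rcons_last -[RHS](tnth_rcons_last z t); congr tnth.
by apply: val_inj; rewrite /= /bump -ltnS ltn_ord.
Qed.

Lemma bd_cone0 z (c : chain 0) : bd (cone z c) = c.
Proof.
rewrite /bd big_ord1 expr0 scale1r push_comp -[RHS]push_id.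
by apply: eq_push => t; rewrite [ord0]ord1 -(ord1 ord_max) del_rcons_max.
Qed.

Lemma bd_coneS z n (c : chain n.+1) :
  bd (cone z c) = cone z (bd c) + (-1) ^+ n.+1 *: c.
Proof.
rewrite /bd big_ord_recr /= push_comp; congr (_ + _).
  rewrite linear_sum /=; apply: eq_bigr => i _; rewrite linearZ /=.
  rewrite /cone !push_comp; congr (_ *: _); apply: eq_push => t.
  exact: del_rcons_widen.
congr (_ *: _); rewrite -[RHS]push_id; apply: eq_push => t.
exact: del_rcons_max.
Qed.

Lemma cone_rcons z w n (c : chain n) t :
  cone z c (rcons_vertex w t) = if w == z then c t else 0.
Proof.
rewrite ffunE; case: eqP => [->|wz].
  rewrite (bigD1 t) //= big1 ?addr0 // => u /andP [/eqP e].
  by case: (rcons_vertex_inj e) => _ ->; rewrite eqxx.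
by apply: big1 => u /eqP e; case: (rcons_vertex_inj e) => zw; case: wz.
Qed.

Lemma slice_cone z w n (c : chain n) :
  slice w (cone z c) = if w == z then c else 0.
Proof.
by apply/ffunP => t; rewrite ffunE cone_rcons; case: eqP => // _; rewrite ffunE.
Qed.

Lemma chain_sum_cones n (c : chain n.+1) : c = \sum_z cone z (slice z c).
Proof.
apply/ffunP => s; have [w [t ->]] := rcons_vertexP s.
rewrite sum_ffunE (bigD1 w) //= cone_rcons eqxx ffunE big1 ?addr0 // => z zw.
by rewrite cone_rcons eq_sym (negbTE zw).
Qed.

(** By induction on the length: every chain is a sum of cones, and on a cone the boundary formula
    leaves two copies of [bd] of the base with opposite signs. *)
Lemma bd_bd n (c : chain n.+2) : bd (bd c) = 0.
Proof.
have bd_sum j (F : T -> chain j.+1) : bd (\sum_z F z) = \sum_z bd (F z).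
  exact: linear_sum.
elim: n c => [|n IH] c; rewrite (chain_sum_cones c) !bd_sum big1 // => z _.
  rewrite bd_coneS linearD /= bd_cone0 linearZ /= expr1 scaleN1r.
  by rewrite addrN.
rewrite bd_coneS linearD /= bd_coneS IH linear0 add0r linearZ /=.
by rewrite [(-1) ^+ n.+2]exprS mulN1r scaleNr addrN.
Qed.

End OrderedChains.

(** * Homology of order complexes and deletion of elements *)

Section Acyclicity.
Variables (k : fieldType) (T : finType) (lt : rel T).
Hypotheses (lt_trans : transitive lt) (lt_irr : irreflexive lt).

Notation chain n := {ffun n.-tuple T -> k^o}.
Implicit Types (Q D L M N : {set T}).

Definition below Q z : {set T} := [set y in Q | lt y z].

Lemma chain_predP Q n (s : n.-tuple T) :
  reflect ((forall i, tnth s i \in Q) /\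
           (forall i j : 'I_n, (i < j)%N -> lt (tnth s i) (tnth s j)))
          (chain_pred lt Q s).
Proof.
rewrite /chain_pred sorted_pairwise //; apply: (iffP andP) => - [].
  move=> pw /allP inQ; split=> [i|i j ij]; first exact/inQ/mem_tnth.
  have x0 := tnth s i; have /(pairwiseP x0) H := pw.
  by rewrite !(tnth_nth x0); apply: H; rewrite ?inE ?size_tuple.
move=> inQ mono; split; last first.
  by apply/allP => y /tnthP [i ->]; apply: inQ.
case: n s inQ mono => [|n] s inQ mono; first by rewrite tuple0.
have x0 := thead s; apply/(pairwiseP x0) => i j.
rewrite !inE size_tuple => li lj ij.
by have := mono (Ordinal li) (Ordinal lj) ij; rewrite !(tnth_nth x0).
Qed.

Lemma chain_pred_rcons Q z n (t : n.-tuple T) :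
  chain_pred lt Q (rcons_vertex z t)
  = (z \in Q) && chain_pred lt (below Q z) t.
Proof.
rewrite /chain_pred !sorted_pairwise //= pairwise_rcons all_rcons.
have -> : all (fun y => y \in below Q z) t
          = all (fun y => y \in Q) t && all (lt^~ z) t.
  by rewrite -all_predI; apply: eq_all => y; rewrite /= inE.
case: (z \in Q); rewrite /= ?andbF // [RHS]andbA [RHS]andbC.
by case: (all (lt^~ z) t).
Qed.

Lemma chain_pred_sub Q D n (t : n.-tuple T) :
  Q \subset D -> chain_pred lt Q t -> chain_pred lt D t.
Proof.
move=> /subsetP QD /andP [st /allP tQ]; rewrite /chain_pred st.
by apply/allP => y /tQ /QD.
Qed.

Lemma chain_pred_del Q n (i : 'I_n.+1) (s : n.+1.-tuple T) :
  chain_pred lt Q s -> chain_pred lt Q (del_vertex i s).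
Proof.
move=> /chain_predP [inQ mono]; apply/chain_predP; split=> [j|j l jl].
  by rewrite tnth_mktuple.
rewrite !tnth_mktuple; apply: mono; rewrite /= /bump.
by case: leqP; case: leqP; rewrite ?add0n ?add1n ?ltnS //; lia.
Qed.

Definition supp Q n (c : chain n) := forall t, c t != 0 -> chain_pred lt Q t.

Lemma supp_sub Q D n (c : chain n) : Q \subset D -> supp Q c -> supp D c.
Proof. by move=> QD sc t /sc; apply: chain_pred_sub. Qed.

Lemma suppD Q n (c c' : chain n) : supp Q c -> supp Q c' -> supp Q (c + c').
Proof.
move=> sc sc' t; rewrite ffunE; have [c0|/sc //] := eqVneq (c t) 0.
by rewrite c0 add0r => /sc'.
Qed.

Lemma suppZ Q n a (c : chain n) : supp Q c -> supp Q (a *: c).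
Proof.
move=> sc t; rewrite ffunE => H; apply: sc.
by apply: contraNneq H => ->; rewrite scaler0.
Qed.

Lemma suppN Q n (c : chain n) : supp Q c -> supp Q (- c).
Proof. by rewrite -scaleN1r; apply: suppZ. Qed.

Lemma suppB Q n (c c' : chain n) : supp Q c -> supp Q c' -> supp Q (c - c').
Proof. by move=> sc sc'; apply/suppD => //; apply: suppN. Qed.

Lemma supp0 Q n : supp Q (0 : chain n).
Proof. by move=> t; rewrite ffunE eqxx. Qed.

Lemma supp_bd Q n (c : chain n.+1) : supp Q c -> supp Q (bd c).
Proof.
move=> sc; rewrite /bd; elim/big_rec: _ => [|i b _ sb]; first exact: supp0.
apply: suppD => //; apply: suppZ => t /push_supp [s <- /sc].
exact: chain_pred_del.
Qed.

Lemma supp_cone Q z n (c : chain n) :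
  z \in Q -> supp (below Q z) c -> supp Q (cone z c).
Proof.
by move=> zQ sc s /push_supp [t <- /sc]; rewrite chain_pred_rcons zQ.
Qed.

Lemma supp_slice Q z n (c : chain n.+1) :
  supp Q c -> supp (below Q z) (slice z c).
Proof.
by move=> sc t; rewrite ffunE => /sc; rewrite chain_pred_rcons => /andP[].
Qed.

Lemma slice_notin Q z n (c : chain n.+1) :
  z \notin Q -> supp Q c -> slice z c = 0.
Proof.
move=> zQ sc; apply/ffunP => t; rewrite !ffunE; apply/eqP.
by apply: contraNT zQ => /sc; rewrite chain_pred_rcons => /andP[].
Qed.

(* The last vertex is the largest one, so a chain that does not end in a
   maximal element [z] avoids [z] altogether. *)
Lemma supp_remove_max Q z n (c : chain n.+1) :
  (forall y, y \in Q -> ~~ lt z y) ->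
  supp Q c -> supp (Q :\ z) (c - cone z (slice z c)).
Proof.
move=> zmax sc s; have [w [t ->]] := rcons_vertexP s.
have subE (d : chain n.+1) u : (c - d) u = c u - d u by rewrite !ffunE.
rewrite subE cone_rcons; case: (w =P z) => [->|/eqP wz].
  by rewrite ffunE subrr eqxx.
rewrite subr0 => cnz.
have := sc _ cnz; rewrite !chain_pred_rcons !inE wz => /andP [wQ ct].
rewrite wQ; apply: chain_pred_sub ct; apply/subsetP => y; rewrite !inE.
move=> /andP [-> yw]; rewrite yw andbT andbT.
apply: contraNneq (zmax _ wQ) => <-.
exact: yw.
Qed.

Definition cyc n : chain n -> Prop :=
  match n with 0 => fun=> True | n'.+1 => fun c => bd c = 0 end.

(** The counterpart of [reduced_homology_zero] for functions on all tuples; [n] again counts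
    vertices. *)
Definition hzero Q n :=
  forall c : chain n, supp Q c -> cyc c -> exists2 b, supp Q b & c = bd b.

Definition acyclic Q := forall n, hzero Q n.

Lemma cyc_bd n (c : chain n.+1) : cyc (bd c).
Proof. by case: n c => //= n c; rewrite bd_bd. Qed.

Lemma cycB n (c c' : chain n) : cyc c -> cyc c' -> cyc (c - c').
Proof. by case: n c c' => //= n c c' H H'; rewrite linearB /= H H' subrr. Qed.

Lemma supp_empty n (c : chain n.+1) : supp set0 c -> c = 0.
Proof.
move=> sc; apply/ffunP => t; rewrite ffunE; apply/eqP.
apply: contraTT isT => /sc /chain_predP [/(_ ord0)].
by rewrite inE.
Qed.

Lemma supp_chain0 Q (c : chain 0) : supp Q c.
Proof. by move=> t _; rewrite tuple0. Qed.

Lemma suppI Q D n (c : chain n) : supp Q c -> supp D c -> supp (Q :&: D) c.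
Proof.
move=> sQ sD t nz; have /andP [st /allP tQ] := sQ _ nz.
have /andP [_ /allP tD] := sD _ nz; rewrite /chain_pred st.
by apply/allP => y yt; rewrite inE tQ ?tD.
Qed.

(** An element with the most elements of [D] below it is maximal: anything above it would have it as
    one more element below. *)
Lemma ex_max_elt D : D != set0 ->
  exists2 z, z \in D & forall y, y \in D -> ~~ lt z y.
Proof.
case/set0Pn => z0 z0D.
case: (@arg_maxnP _ z0 (mem D) (fun z => #|below D z|) z0D) => z.
rewrite inE => zD zmax.
exists z => // y yD; apply: contraTN (zmax y yD) => zy.
rewrite -ltnNge; apply: proper_card; apply/properP; split.
  by apply/subsetP => x; rewrite !inE => /andP [-> /lt_trans ->].
by exists z; rewrite !inE ?zD ?zy ?lt_irr ?andbF.
Qed.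

Definition order_ideal L D :=
  D \subset L /\ forall x y, x \in D -> y \in L -> lt y x -> y \in D.

Lemma order_ideal_below L z : order_ideal L (below L z).
Proof.
split; first by apply/subsetP => x; rewrite inE => /andP [].
move=> x y; rewrite !inE => /andP [_ xz] -> yx; exact: lt_trans xz.
Qed.

(** Relative cycles modulo the chains of [N]. *)
Definition cycle_mod N n : chain n -> Prop :=
  match n with 0 => fun=> True | n'.+1 => fun c => supp N (bd c) end.

Lemma cycle_mod_sub N M n (c : chain n) :
  N \subset M -> cycle_mod N c -> cycle_mod M c.
Proof. by case: n c => //= n c; apply: supp_sub. Qed.

(* That is, the inclusion of the chains of [D :&: N] into those of [D] is a
   quasi-isomorphism.  The proof removes a maximal element [z] of [D]: modulo
   the chains avoiding [z], a chain of [D] is a cone over a chain of elements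
   below [z]. *)
Lemma relatively_acyclic L N D :
  (forall y, y \in L -> y \notin N -> acyclic (below L y)) ->
  order_ideal L D ->
  forall n (c : chain n), supp D c -> cycle_mod (D :&: N) c ->
  exists2 b : chain n.+1, supp D b & supp (D :&: N) (c - bd b).
Proof.
move=> acL; have [m] := ubnP #|D|; elim: m D => // m IH D /ltnSE leDm idD.
(* The empty tuple is a chain of every set, so on zero vertices nothing has to be corrected. *)
case=> [|n] c sc; first by exists 0; [apply: supp0 | apply: supp_chain0].
rewrite /= => sbc; have [D0|/ex_max_elt [z zD zmax]] := eqVneq D set0.
  have -> : c = 0 by apply: supp_empty; rewrite -D0.
  exists 0; first exact: supp0.
  by rewrite linear0 subr0; apply: supp0.
set c1 := slice z c; set c0 := c - cone z c1.
have [DL Dclosed] := idD.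
have zL : z \in L by apply: (subsetP DL).
have belowD : below D z = below L z.
  apply/setP => y; rewrite !inE; apply/andP/andP => - [yD yz]; split=> //.
    exact: (subsetP DL).
  exact: Dclosed yz.
have idE := order_ideal_below L z.
have ED : below L z \subset D :\ z.
  apply/subsetP => y; rewrite -belowD !inE => /andP [-> yz]; rewrite andbT.
  by apply: contraTneq yz => ->; rewrite lt_irr.
have sc0 : supp (D :\ z) c0 by apply: supp_remove_max.
have sc1 : supp (below L z) c1 by rewrite -belowD; apply: supp_slice.
have zE : z \notin below L z by rewrite inE lt_irr andbF.
have cE : c = c0 + cone z c1 by rewrite subrK.
(* Slicing at [z] commutes with the boundary here: [bd c0] and [c1] avoid [z], so only
   [cone z (bd c1)] contributes. *)
have [bc1 zc1] : cycle_mod (below (D :&: N) z) c1 /\ (z \notin N -> cyc c1).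
  case: n c c1 c0 sc sbc sc0 sc1 cE => //= n c c1 c0 sc sbc sc0 sc1 cE.
  suff <- : slice z (bd c) = bd c1.
    split=> [|zN]; first exact: supp_slice.
    by apply: slice_notin sbc; rewrite inE (negbTE zN) andbF.
  rewrite cE linearD linearD /= (slice_notin (z := z) (Q := D :\ z)).
  - rewrite bd_coneS linearD /= slice_cone eqxx linearZ /=.
    by rewrite (slice_notin zE sc1) scaler0 addr0 add0r.
  - by rewrite !inE eqxx.
  - exact: supp_bd.
(* If [z] is in [N], induction applies to the smaller ideal below [z]; otherwise [c1] is a cycle
   below [z] and bounds by acyclicity. *)
have [b1 sb1 sN1] : exists2 b1 : chain n.+1, supp (below L z) b1
    & supp (D :&: N) (cone z (c1 - bd b1)).
  have [zN|zN] := boolP (z \in N).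
    have sub : below (D :&: N) z \subset below L z :&: N.
      apply/subsetP => y; rewrite -belowD !inE.
      by case: (y \in D); case: (y \in N); case: (lt y z).
    have bc1' := cycle_mod_sub sub bc1.
    have [|b1 sb1 sN1] := IH (below L z) _ idE _ _ sc1 bc1'.
      apply: leq_trans leDm; apply: leq_ltn_trans (subset_leq_card ED) _.
      by rewrite [X in (_ < X)%N](cardsD1 z D) zD.
    exists b1 => //; apply: supp_cone; first by rewrite inE zD.
    apply: supp_sub sN1; apply/subsetP => y; rewrite -belowD !inE.
    by case: (y \in D); case: (y \in N); case: (lt y z).
  have [b1 sb1 ->] := acL z zL zN n c1 sc1 (zc1 zN).
  by exists b1 => //; rewrite subrr linear0; apply: supp0.
(* What is left of [c] after removing [bd (cone z b1)] and a cone already in [D :&: N]; it avoids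
   [z], so induction applies to [D :\ z]. *)
set c' := c0 - (-1) ^+ n.+1 *: b1.
have bcone : bd (cone z b1) = cone z (bd b1) + (-1) ^+ n.+1 *: b1.
  exact: bd_coneS.
have splitc : c - bd (cone z b1) = c' + cone z (c1 - bd b1).
  by rewrite {1}cE bcone [cone z (bd b1) + _]addrC opprD addrACA linearB.
have sc' : supp (D :\ z) c'.
  by apply: suppB => //; apply: suppZ; apply: supp_sub sb1.
have sbc' : supp ((D :\ z) :&: N) (bd c').
  rewrite -(setIidPl (subD1set D z)) -setIA; apply: suppI.
    exact: supp_bd.
  have -> : c' = c - bd (cone z b1) - cone z (c1 - bd b1).
    by rewrite splitc addrK.
  rewrite !(linearB (@bd k T n)) /= bd_bd subr0.
  by apply: suppB => //; apply: supp_bd.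
have idD' : order_ideal L (D :\ z).
  split; first by apply: subset_trans DL; apply: subD1set.
  move=> x y; rewrite !inE => /andP [_ xD] yL yx; rewrite (Dclosed x) // andbT.
  by apply: contraTneq yx => ->; apply: zmax.
have [|b' sb' sN'] := IH (D :\ z) _ idD' n.+1 c' sc' sbc'.
  by apply: leq_trans leDm; rewrite (cardsD1 z D) zD.
exists (cone z b1 + b').
  apply: suppD; last by apply: supp_sub sb'; apply: subD1set.
  by apply: supp_cone => //; rewrite belowD.
rewrite linearD /= opprD addrA splitc addrAC; apply: suppD => //.
by apply: supp_sub sN'; apply: setSI; apply: subD1set.
Qed.

(** A chain of [D] whose boundary lies in [D :&: N] can be corrected by a boundary into [D :&: N].
    Apply this to a chain filling a cycle of [D :&: N], respectively to a cycle of [D]. *)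
Lemma acyclic_ideal L N D :
  (forall y, y \in L -> y \notin N -> acyclic (below L y)) ->
  order_ideal L D -> acyclic D <-> acyclic (D :&: N).
Proof.
move=> acL idD; have rel := relatively_acyclic acL idD.
have sub : D :&: N \subset D by apply: subsetIl.
split=> ac n c sc cc.
  have [b sb cE] := ac n c (supp_sub sub sc) cc.
  have [|e se sbe] := rel n.+1 b sb; first by rewrite /= -cE.
  by exists (b - bd e) => //; rewrite linearB /= bd_bd subr0.
have [|b sb sbc] := rel n c sc.
  by case: n c sc cc => //= n c sc ->; apply: supp0.
have [|e se ceE] := ac n _ sbc.
  by apply: cycB => //; apply: cyc_bd.
exists (b + e); first by apply: suppD => //; apply: supp_sub se.
by rewrite linearD /= -ceE addrC subrK.
Qed.

(* The homotopy is the cone over the top element; chains already containing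
   the top element need to be split off first. *)
Lemma acyclic_top Q z :
  z \in Q -> (forall y, y \in Q -> y != z -> lt y z) -> acyclic Q.
Proof.
move=> zQ ztop; case=> [|n] c sc cc.
  exists (cone z c); last by rewrite bd_cone0.
  by apply: supp_cone => //; apply: supp_chain0.
have zmax y : y \in Q -> ~~ lt z y.
  move=> yQ; apply/negP => zy; have yz : y != z.
    by apply: contraTneq zy => ->; rewrite lt_irr.
  by have := lt_trans zy (ztop y yQ yz); rewrite lt_irr.
set c1 := slice z c; set c0 := c - cone z c1.
have sc0 : supp (Q :\ z) c0 by apply: supp_remove_max.
have cE : c = c0 + cone z c1 by rewrite subrK.
have Qz : Q :\ z = below Q z.
  apply/setP => y; rewrite !inE andbC.
  case: (boolP (y \in Q)) => //= yQ; case: eqP => [->|/eqP /(ztop y yQ) -> //].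
  by rewrite lt_irr.
have sc1 : supp (Q :\ z) c1 by rewrite Qz; apply: supp_slice.
(* Slicing [bd c = 0] at [z] gives [bd c1 = 0]; what remains of the equation expresses [bd c0]
   through [c1], so a cone over [c0] fills all of [c]. *)
have bc0 : bd c0 = - ((-1) ^+ n *: c1).
  have : bd (c0 + cone z c1) = 0 by rewrite -cE.
  move: {cE sc cc} (c0) (c1) sc0 sc1 => {c1 c0} c0 c1.
  case: n {c} c0 c1 => [|n] c0 c1 sc0 sc1; rewrite linearD /=.
    by rewrite bd_cone0 expr0 scale1r => /eqP; rewrite addr_eq0 => /eqP.
  have zQz : z \notin Q :\ z by rewrite !inE eqxx.
  rewrite bd_coneS => bc; have bc1 : bd c1 = 0.
    have := congr1 (@slice k T z _) bc; rewrite linear0 !linearD linearZ /=.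
    rewrite (slice_notin zQz (supp_bd sc0)) (slice_notin zQz sc1).
    by rewrite slice_cone eqxx scaler0 add0r addr0.
  by move: bc; rewrite bc1 linear0 add0r => /eqP; rewrite addr_eq0 => /eqP.
exists ((-1) ^+ n.+1 *: cone z c0).
  by apply: suppZ; apply: supp_cone => //; rewrite -Qz.
rewrite linearZ /= bd_coneS scalerDr scalerA -expr2 sqrr_sign scale1r bc0.
rewrite linearN linearZ /= scalerN scalerA -exprD addSn addnn exprS.
by rewrite -signr_odd odd_double expr0 mulr1 scaleN1r opprK addrC.
Qed.

End Acyclicity.

(** * Translation between faces, tuples and row vectors *)

Section ChainCoordinates.
Variables (k : fieldType) (T : finType) (lt : rel T).
Hypotheses (lt_trans : transitive lt).
Variable Q : {set T}.

Notation chain n := {ffun n.-tuple T -> k^o}.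

(** The coefficient of [t] in the boundary of [s]; a sum, because a tuple with repetitions can give
    [t] by deletion at several positions. *)
Definition incidence n (s : n.+1.-tuple T) (t : n.-tuple T) : k :=
  \sum_(i < n.+1 | del_vertex i s == t) (-1) ^+ i.

Lemma bdE n (c : chain n.+1) t : bd c t = \sum_s c s * incidence s t.
Proof.
rewrite /bd sum_ffunE; under eq_bigr do rewrite !ffunE scaler_sumr big_mkcond.
rewrite exchange_big /=; apply: eq_bigr => s _.
rewrite mulr_sumr [RHS]big_mkcond.
by apply: eq_bigr => i _; case: ifP => // _; rewrite mulrC.
Qed.

Lemma sboundaryE n (c : schain k lt Q n.+1) t :
  sboundary c t = \sum_s c s * incidence (val s) (val t).
Proof.
rewrite ffunE; apply: eq_bigr => s _; rewrite mulr_sumr.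
by apply: eq_bigr => i _; rewrite mulrC.
Qed.

Definition chain_of_schain n (c : schain k lt Q n) : chain n :=
  [ffun t => \sum_(s : face lt Q n | val s == t) c s].

Definition schain_of_chain n (c : chain n) : schain k lt Q n :=
  [ffun s => c (val s)].

Lemma chain_of_schainK n : cancel (@chain_of_schain n) (@schain_of_chain n).
Proof.
move=> c; apply/ffunP => s; rewrite !ffunE.
by under eq_bigl do rewrite val_eqE; rewrite big_pred1_eq.
Qed.

Lemma supp_chain_of_schain n (c : schain k lt Q n) :
  supp lt Q (chain_of_schain c).
Proof.
move=> t; rewrite ffunE; have [//|nch] := boolP (chain_pred lt Q t).
rewrite big_pred0 ?eqxx // => s; apply: contraNF nch => /eqP <-.
exact: valP s.
Qed.

Lemma schain_of_chain_inj n (c c' : chain n) : supp lt Q c -> supp lt Q c' ->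
  schain_of_chain c = schain_of_chain c' -> c = c'.
Proof.
move=> sc sc' e; apply/ffunP => t; have [ct|nct] := boolP (chain_pred lt Q t).
  by have /ffunP /(_ (Sub t ct)) := e; rewrite !ffunE SubK.
have zero (d : chain n) : supp lt Q d -> d t = 0.
  by move=> sd; apply/eqP; apply: contraNT nct => /sd.
by rewrite !zero.
Qed.

Lemma schain_bd n (c : chain n.+1) : supp lt Q c ->
  schain_of_chain (bd c) = sboundary (schain_of_chain c).
Proof.
move=> sc; apply/ffunP => t; rewrite sboundaryE ffunE bdE.
rewrite (bigID (chain_pred lt Q (n := n.+1))) /= [X in _ + X]big1 ?addr0.
  rewrite (big_sub (chain_pred lt Q (n := n.+1))).
  by apply: eq_bigr => s _; rewrite ffunE.
move=> s nch; suff -> : c s = 0 by rewrite mul0r.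
by apply/eqP; apply: contraNT nch => /sc.
Qed.

Lemma schain_of_chain0 n : schain_of_chain (0 : chain n) = 0.
Proof. by apply/ffunP => s; rewrite !ffunE. Qed.

(** Extension by zero and restriction identify functions on the faces with chains supported in [Q],
    compatibly with boundaries. *)
Lemma reduced_homology_zeroP n :
  reduced_homology_zero k lt Q n <-> hzero k lt Q n.
Proof.
split=> [H c sc cc|H c cc].
  have [|b cE] := H (schain_of_chain c).
    case: n c sc cc {H} => //= n c sc bc.
    by rewrite -schain_bd // bc schain_of_chain0.
  exists (chain_of_schain b); first exact: supp_chain_of_schain.
  apply: schain_of_chain_inj => //.
    by apply: supp_bd => //; apply: supp_chain_of_schain.
  rewrite schain_bd ?chain_of_schainK //; exact: supp_chain_of_schain.
have [||b sb cE] := H (chain_of_schain c); first exact: supp_chain_of_schain.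
  case: n c cc {H} => //= n c bc.
  apply: schain_of_chain_inj; first exact/supp_bd/supp_chain_of_schain.
    exact: supp0.
  rewrite schain_bd ?chain_of_schainK ?bc ?schain_of_chain0 //.
  exact: supp_chain_of_schain.
exists (schain_of_chain b).
by rewrite -schain_bd // -cE chain_of_schainK.
Qed.

Definition chains n : {set n.-tuple T} := [set s | chain_pred lt Q s].

Definition chain_of_row n (v : 'rV[k]_#|chains n|) : chain n :=
  [ffun t => \sum_(i | enum_val i == t) v 0 i].

Definition row_of_chain n (c : chain n) : 'rV[k]_#|chains n| :=
  \row_i c (enum_val i).

Definition bdmx n : 'M[k]_(#|chains n.+1|, #|chains n|) :=
  \matrix_(i, j) incidence (enum_val i) (enum_val j).

Lemma chain_of_rowE n (v : 'rV[k]_#|chains n|) i :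
  chain_of_row v (enum_val i) = v 0 i.
Proof.
rewrite ffunE; under eq_bigl do rewrite (inj_eq enum_val_inj).
exact: big_pred1_eq.
Qed.

Lemma chain_of_rowK n : cancel (@chain_of_row n) (@row_of_chain n).
Proof. by move=> v; apply/rowP => i; rewrite mxE chain_of_rowE. Qed.

Lemma chain_of_row_nz n (v : 'rV[k]_#|chains n|) t :
  chain_of_row v t != 0 -> exists2 i, t = enum_val i & v 0 i != 0.
Proof.
have [tch|ntch] := boolP (t \in chains n).
  by rewrite -(enum_rankK_in tch tch) chain_of_rowE; eexists.
rewrite ffunE big_pred0 ?eqxx // => i.
by apply: contraNF ntch => /eqP <-; apply: enum_valP.
Qed.

Lemma supp_chain_of_row n (v : 'rV[k]_#|chains n|) :
  supp lt Q (chain_of_row v).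
Proof.
by move=> t /chain_of_row_nz [i -> _]; have := enum_valP i; rewrite inE.
Qed.

Lemma row_of_chain_inj n (c c' : chain n) : supp lt Q c -> supp lt Q c' ->
  row_of_chain c = row_of_chain c' -> c = c'.
Proof.
move=> sc sc' e; apply/ffunP => t; have [ct|nct] := boolP (t \in chains n).
  have /rowP /(_ (enum_rank_in ct t)) := e.
  by rewrite !mxE (enum_rankK_in ct ct).
have zero (d : chain n) : supp lt Q d -> d t = 0.
  by move=> sd; apply/eqP; apply: contraNT nct => /sd; rewrite inE.
by rewrite !zero.
Qed.

Lemma row_of_chainK n (c : chain n) : supp lt Q c ->
  chain_of_row (row_of_chain c) = c.
Proof.
move=> sc; apply: row_of_chain_inj (chain_of_rowK _) => //.
exact: supp_chain_of_row.
Qed.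

Lemma row_bd n (c : chain n.+1) : supp lt Q c ->
  row_of_chain (bd c) = row_of_chain c *m bdmx n.
Proof.
move=> sc; apply/rowP => j; rewrite !mxE bdE.
rewrite (bigID (mem (chains n.+1))) /= [X in _ + X]big1 ?addr0.
  by rewrite big_enum_val; apply: eq_bigr => i _; rewrite !mxE.
move=> s nch; suff -> : c s = 0 by rewrite mul0r.
by apply/eqP; apply: contraNT nch => /sc; rewrite inE.
Qed.

Lemma chain_of_row_bd n (v : 'rV[k]_#|chains n.+1|) :
  chain_of_row (v *m bdmx n) = bd (chain_of_row v).
Proof.
apply: row_of_chain_inj; first exact: supp_chain_of_row.
  by apply: supp_bd => //; apply: supp_chain_of_row.
by rewrite chain_of_rowK row_bd ?chain_of_rowK //; apply: supp_chain_of_row.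
Qed.

Lemma chain_of_row0 n : chain_of_row (0 : 'rV[k]_#|chains n|) = 0.
Proof. by apply/ffunP => t; rewrite !ffunE big1 // => i _; rewrite mxE. Qed.

End ChainCoordinates.

(** * Multigraded resolutions *)

Section ScalarReduction.
Variables (k : fieldType) (m : nat).

Notation R := {mpoly k[m]}.
Notation Zm := {ffun 'I_m -> int}.
Implicit Types (a b d g h : Zm) (p q : R) (I : R -> Prop).

Definition leZ a b : Prop := forall i, a i <= b i.

Definition expZ (e : 'X_{1..m}) : Zm := [ffun i => (e i)%:Z].

(* Only meaningful when [d] is nonnegative. *)
Definition mnmZ d : 'X_{1..m} := [multinom `|d i|%N | i < m].

(* A homogeneous polynomial is a scalar multiple of a monomial determined by
   its degree, so setting all variables to [1] loses no information on it. *)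
Definition ev1 : R -> k := meval (fun=> 1).

Lemma leZ_trans a b d : leZ a b -> leZ b d -> leZ a d.
Proof. by move=> ab bd i; apply: le_trans (bd i). Qed.

Lemma leZ_refl a : leZ a a. Proof. by []. Qed.

Lemma leZ_anti a b : leZ a b -> leZ b a -> a = b.
Proof. by move=> ab ba; apply/ffunP => i; apply/eqP; rewrite eq_le ab ba. Qed.

Lemma leZP a b : reflect (leZ a b) [forall i, a i <= b i].
Proof. exact: forallP. Qed.

Lemma expZK : cancel expZ mnmZ.
Proof. by move=> e; apply/mnmP => i; rewrite mnmE ffunE. Qed.

Lemma mnmZK d : leZ 0 d -> expZ (mnmZ d) = d.
Proof.
by move=> d0; apply/ffunP => i; have := d0 i; rewrite !ffunE mnmE => /gez0_abs.
Qed.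

Lemma subZ_ge0 a b : leZ b a -> leZ 0 (a - b).
Proof. by move=> H i; rewrite !ffunE subr_ge0. Qed.

Lemma leZ_sub a b : leZ 0 (a - b) -> leZ b a.
Proof. by move=> H i; have := H i; rewrite !ffunE subr_ge0. Qed.

Lemma mnmZD a b : leZ 0 a -> leZ 0 b -> mnmZ (a + b) = (mnmZ a + mnmZ b)%MM.
Proof.
have abszD (x y : int) : 0 <= x -> 0 <= y ->
    absz (x + y) = (absz x + absz y)%N by lia.
move=> a0 b0; apply/mnmP => i; rewrite mnmDE !mnmE ffunE.
by apply: abszD; [have := a0 i | have := b0 i]; rewrite ffunE.
Qed.

Lemma leZ_expZ e e' : leZ (expZ e) (expZ e') <-> (e <= e')%MM.
Proof.
split=> [H|/mnm_lepP H i]; last by rewrite !ffunE lez_nat.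
by apply/mnm_lepP => i; have := H i; rewrite !ffunE lez_nat.
Qed.

Lemma ev1X e : ev1 'X_[e] = 1.
Proof. by rewrite /ev1 mevalX big1 // => i _; rewrite expr1n. Qed.

Lemma ev1Z c p : ev1 (c *: p) = c * ev1 p.
Proof. exact: mevalZ. Qed.

HB.instance Definition _ := GRing.RMorphism.on ev1.

(** Only the exponent [mnmZ d] can occur in [p]. If [d] has a negative coordinate, [p] is zero and
    both sides vanish. *)
Lemma homogeneousE d p : homogeneous d p -> p = ev1 p *: 'X_[mnmZ d].
Proof.
move=> hp; have pE : p = p@_(mnmZ d) *: 'X_[mnmZ d].
  apply/mpolyP => e; rewrite mcoeffZ mcoeffX.
  have [<-|ne] := eqVneq; first by rewrite mulr1.
  rewrite mulr0; apply: memN_msupp_eq0; apply: contraNN ne => /hp he.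
  by apply/eqP/mnmP => i; rewrite mnmE -he.
by rewrite {2}pE ev1Z ev1X mulr1.
Qed.

Lemma homogeneous_ev1_neq0 d p : homogeneous d p -> ev1 p != 0 -> leZ 0 d.
Proof.
move=> hp nz i; rewrite ffunE.
case sp: (msupp p) => [|e s].
  by move: nz; rewrite (msuppnil0 sp) /ev1 meval0 eqxx.
have ep : e \in msupp p by rewrite sp mem_head.
by rewrite -(hp e ep).
Qed.

Lemma homogeneous0 d : homogeneous d (0 : R).
Proof. by move=> e; rewrite msupp0. Qed.

Lemma homogeneousX d (c : k) :
  leZ 0 d -> homogeneous d (c *: 'X_[mnmZ d] : R).
Proof.
move=> d0 e /msuppZ_le; rewrite msuppX inE => /eqP -> i.
by rewrite -[in RHS](mnmZK d0) ffunE.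
Qed.

Lemma homogeneousM d d' p q :
  homogeneous d p -> homogeneous d' q -> homogeneous (d + d') (p * q).
Proof.
move=> hp hq e /msuppM_le /allpairsP [[e1 e2] /= [e1p e2q ->]] i.
by rewrite mnmDE PoszD ffunE (hp e1) // (hq e2).
Qed.

Lemma homogeneousD d p q :
  homogeneous d p -> homogeneous d q -> homogeneous d (p + q).
Proof.
by move=> hp hq e /msuppD_le; rewrite mem_cat => /orP [/hp|/hq].
Qed.

Lemma homogeneous_sum d (J : finType) (f : J -> R) :
  (forall j, homogeneous d (f j)) -> homogeneous d (\sum_j f j).
Proof.
move=> hf; elim/big_rec: _ => [|j p _ hp]; first exact: homogeneous0.
exact: homogeneousD.
Qed.

(** Compares the two reductions to [k]: passing to the residue field agrees with [ev1] in degree 0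
    and kills all other degrees. *)
Lemma homogeneous_const d p :
  homogeneous d p -> p@_0%MM = if d == 0 then ev1 p else 0.
Proof.
move=> hp; case: eqP => [d0|/eqP dn0].
  rewrite [in LHS](homogeneousE hp) mcoeffZ mcoeffX d0.
  suff -> : mnmZ 0 = 0%MM by rewrite eqxx mulr1.
  by apply/mnmP => i; rewrite mnmE ffunE mnm0E.
apply: memN_msupp_eq0; apply: contraNN dn0 => /hp h0.
by apply/eqP/ffunP => i; rewrite -h0 mnm0E ffunE.
Qed.

(* The coefficient of [p] in the degree that a multiple of a generator of
   degree [g] must have to be of degree [a]. *)
Definition comp a g p : k :=
  if [forall i, g i <= a i] then p@_(mnmZ (a - g)) else 0.

Lemma comp_le a g p : comp a g p != 0 -> leZ g a.
Proof. by rewrite /comp; case: leZP => //; rewrite eqxx. Qed.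

Lemma compD a g p q : comp a g (p + q) = comp a g p + comp a g q.
Proof. by rewrite /comp; case: ifP => _; rewrite ?mcoeffD ?addr0. Qed.

Lemma comp0 a g : comp a g 0 = 0.
Proof. by rewrite /comp mcoeff0 if_same. Qed.

Lemma comp_sum a g (J : finType) (f : J -> R) :
  comp a g (\sum_j f j) = \sum_j comp a g (f j).
Proof.
by apply: (big_morph (comp a g)); [move=> p q; rewrite compD | rewrite comp0].
Qed.

(** [q] is [ev1 q] times the monomial of degree [g - h], so multiplying by it only shifts the
    exponent at which the coefficient is read. *)
Lemma comp_mul a g h p q :
  homogeneous (g - h) q -> comp a h (p * q) = comp a g p * ev1 q.
Proof.
move=> hq; have [q0|nz] := eqVneq (ev1 q) 0.
  by rewrite q0 mulr0 (homogeneousE hq) q0 scale0r mulr0 comp0.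
have hg : leZ h g by apply: leZ_sub; apply: homogeneous_ev1_neq0 nz.
rewrite {1}(homogeneousE hq) -scalerAr /comp.
case: (leZP h a) => [ha|nha]; last first.
  case: (leZP g a) => [ga|_]; last by rewrite mul0r.
  by case: nha; apply: leZ_trans hg ga.
rewrite mcoeffZ mulrC; congr (_ * _); case: (leZP g a) => [ga|nga].
  have -> : a - h = (a - g) + (g - h) by rewrite addrA subrK.
  by rewrite addrC (mnmZD (a := g - h)) ?mcoeffMX //; apply: subZ_ge0.
(* When [g] is not below [a], the monomial of degree [a - h] is not a multiple of that of degree
   [g - h]. *)
apply: memN_msupp_eq0; rewrite (perm_mem (msuppMX p _)).
have lem (x y z : int) (n : nat) :
    z <= x -> z <= y -> absz (x - z) = (absz (y - z) + n)%N ->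
    y <= x by lia.
apply/mapP => - [e _ eE]; apply: nga => i; apply: (lem _ _ (h i) (e i)) => //.
by have /mnmP /(_ i) := eE; rewrite mnmDE !mnmE !ffunE.
Qed.

End ScalarReduction.

(** * Strands of an augmented multigraded complex *)

Section AugmentedComplex.
Variables (k : fieldType) (m : nat) (F : free_complex k m).

Notation R := {mpoly k[m]}.
Notation Zm := {ffun 'I_m -> int}.
Implicit Types (a : Zm) (I : R -> Prop).

(* The augmented complex, with R in position 0 and F_n in position n + 1. *)
Definition arank n := if n is n'.+1 then grank F n' else 1%N.

Definition adeg n : 'I_(arank n) -> Zm :=
  match n with 0 => fun=> 0 | n'.+1 => @gdeg k m F n' end.

Definition adiff n : 'M[R]_(arank n.+1, arank n) :=
  match n with 0 => gaug F | n'.+1 => gdiff F n' end.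

Definition sdiff n : 'M[k]_(arank n.+1, arank n) := map_mx (@ev1 k m) (adiff n).

Definition in_ideal_degree I a := exists2 e, leZ (expZ e) a & I 'X_[e].

(** Position 0 stands for [I] and not for the whole ring, which is what makes the strands exact at
    that end. *)
Definition present I n : 'I_(arank n) -> Zm -> Prop :=
  match n with
  | 0 => fun=> in_ideal_degree I
  | n'.+1 => fun j => leZ (gdeg j)
  end.

(* The rows in degree [a] form the degree [a] strand of the augmented
   complex, with differential [sdiff]. *)
Definition row_in I a n (v : 'rV[k]_(arank n)) :=
  forall j, v 0 j != 0 -> present I j a.

Definition scyc n : 'rV[k]_(arank n) -> Prop :=
  match n with 0 => fun=> True | n'.+1 => fun v => v *m sdiff n' = 0 end.

(** For multigraded complexes and monomial ideals this is equivalent to [resolves], but it is linear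
    algebra over [k], one strand at a time. *)
Definition degreewise_exact I :=
  [/\ forall n i j, sdiff n i j != 0 ->
        forall a, present I i a -> present I j a,
      forall n, sdiff n.+1 *m sdiff n = 0
    & forall n a v, row_in I a v -> @scyc n v ->
        exists2 w, row_in I a w & v = w *m sdiff n].

Definition comp_row a n (V : 'rV[R]_(arank n)) : 'rV[k]_(arank n) :=
  \row_j comp a (adeg j) (V 0 j).

Definition hom_row a n (v : 'rV[k]_(arank n)) : 'rV[R]_(arank n) :=
  \row_j (v 0 j *: 'X_[mnmZ (a - adeg j)]).

Hypothesis mgF : multigraded F.

Lemma adiff_homogeneous n i j : homogeneous (adeg i - adeg j) (adiff n i j).
Proof.
case: n i j => [|n] i j /=; last exact: mgF.1.
by rewrite subr0 [j]ord1; apply: mgF.2.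
Qed.

Arguments adiff_homogeneous [n] i j _ _ _.

Lemma comp_row_mul a n (V : 'rV[R]_(arank n.+1)) :
  comp_row a (V *m adiff n) = comp_row a V *m sdiff n.
Proof.
apply/rowP => j; rewrite !mxE comp_sum; apply: eq_bigr => i _; rewrite !mxE.
exact/comp_mul/adiff_homogeneous.
Qed.

Lemma sdiff_le n i j : sdiff n i j != 0 -> leZ (adeg j) (adeg i).
Proof.
rewrite mxE => nz; apply: leZ_sub.
exact: homogeneous_ev1_neq0 (adiff_homogeneous i j) nz.
Qed.

Lemma hom_row_mul a n (v : 'rV[k]_(arank n.+1)) :
  (forall j, v 0 j != 0 -> leZ (adeg j) a) ->
  hom_row a v *m adiff n = hom_row a (v *m sdiff n).
Proof.
move=> sv; apply/rowP => j; rewrite !mxE scaler_suml; apply: eq_bigr => i _.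
rewrite !mxE; have [->|vi] := eqVneq (v 0 i) 0.
  by rewrite scale0r !mul0r scale0r.
have := homogeneousE (adiff_homogeneous i j); have := @sdiff_le n i j.
rewrite mxE; set c := ev1 _ => le_ji ->.
have [->|nz] := eqVneq c 0; first by rewrite scale0r !mulr0 scale0r.
rewrite -scalerAl -scalerAr scalerA -mpolyXD -mnmZD ?addrA ?subrK //.
  by apply: subZ_ge0; apply: sv.
by apply: subZ_ge0; apply: le_ji.
Qed.

Lemma comp_hom_row a n (v : 'rV[k]_(arank n)) :
  (forall j, v 0 j != 0 -> leZ (adeg j) a) -> comp_row a (hom_row a v) = v.
Proof.
move=> sv; apply/rowP => j; rewrite !mxE.
have [->|vj] := eqVneq (v 0 j) 0; first by rewrite scale0r comp0.
rewrite /comp; case: leZP => [_|[]]; last exact: sv.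
by rewrite mcoeffZ mcoeffX eqxx mulr1.
Qed.

Lemma comp_row_le a n (V : 'rV[R]_(arank n)) j :
  comp_row a V 0 j != 0 -> leZ (adeg j) a.
Proof. by rewrite mxE => /comp_le. Qed.

Lemma hom_row0 a n : hom_row a (0 : 'rV[k]_(arank n)) = 0.
Proof. by apply/rowP => j; rewrite !mxE scale0r. Qed.

Lemma comp_row0 a n : comp_row a (0 : 'rV[R]_(arank n)) = 0.
Proof. by apply/rowP => j; rewrite !mxE comp0. Qed.

(** The list holds the degrees of all monomials in the entries, shifted by the basis degrees;
    removing duplicates keeps a component from being added twice. *)
Lemma sum_hom_rows n (V : 'rV[R]_(arank n)) :
  exists s : seq Zm, V = \sum_(a <- s) hom_row a (comp_row a V).
Proof.
exists (undup (flatten [seq [seq expZ e + adeg j | e <- msupp (V 0 j)]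
                       | j <- enum 'I_(arank n)])).
apply/rowP => j; rewrite summxE; apply/mpolyP => e; rewrite raddf_sum /=.
set s := undup _; pose b := expZ e + adeg j.
have zero a : a != b -> (hom_row a (comp_row a V) 0 j)@_e = 0.
  move=> ab; rewrite !mxE mcoeffZ mcoeffX /comp; case: leZP => ga; last first.
    by rewrite mul0r.
  case: eqP => [ea|]; last by rewrite mulr0.
  case/eqP: ab; rewrite /b -ea mnmZK ?subrK //; exact: subZ_ge0.
have main : (hom_row b (comp_row b V) 0 j)@_e = (V 0 j)@_e.
  rewrite !mxE mcoeffZ mcoeffX /comp /b addrK expZK eqxx mulr1.
  by case: leZP => // - []; apply: leZ_sub; rewrite addrK => i; rewrite !ffunE.
have [bs|bs] := boolP (b \in s).
  by rewrite (bigD1_seq b) ?undup_uniq //= main big1 ?addr0.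
rewrite big_seq big1; last first.
  by move=> a as_; apply: zero; apply: contraNneq bs => <-.
apply: memN_msupp_eq0; apply: contraNN bs => ej; rewrite mem_undup.
apply/flattenP; exists [seq expZ e' + adeg j | e' <- msupp (V 0 j)].
  by apply/mapP; exists j; rewrite ?mem_enum.
by apply/mapP; exists e.
Qed.

(** The entries of the product are homogeneous, hence determined by their values under [ev1]. *)
Lemma adiff_comp n : (forall n, sdiff n.+1 *m sdiff n = 0) ->
  adiff n.+1 *m adiff n = 0.
Proof.
move=> dd; apply/matrixP => i j; rewrite mxE.
have hom : homogeneous (adeg i - adeg j)
             (\sum_l adiff n.+1 i l * adiff n l j).
  apply: homogeneous_sum => l; rewrite -(subrK (adeg l) (adeg i)) -addrA.
  by apply: homogeneousM; apply: adiff_homogeneous.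
rewrite (homogeneousE hom) rmorph_sum /=.
have /matrixP /(_ i j) := dd n; rewrite !mxE => E.
rewrite [X in X *: _](_ : _ = 0) ?scale0r // -[RHS]E.
by apply: eq_bigr => l _; rewrite rmorphM !mxE.
Qed.

(** Each homogeneous component of [V] is lifted in its own strand, and the lifts are added. *)
Lemma lift_rows I n (V : 'rV[R]_(arank n)) :
  degreewise_exact I ->
  (forall a, row_in I a (comp_row a V)) -> (forall a, scyc (comp_row a V)) ->
  exists W, V = W *m adiff n.
Proof.
move=> [_ _ ex] inV cycV; have [s ->] := sum_hom_rows V.
elim: s => [|a s [W IH]]; first by exists 0; rewrite big_nil mul0mx.
have [w sw wE] := ex n a _ (inV a) (cycV a).
by exists (hom_row a w + W); rewrite big_cons IH wE mulmxDl hom_row_mul.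
Qed.

Lemma aug_msupp (V : 'rV[R]_(grank F 0)) p e :
  V *m gaug F = p%:M -> e \in msupp p ->
  exists2 j : 'I_(grank F 0), sdiff 0 j 0 != 0 & leZ (gdeg j) (expZ e).
Proof.
move=> VE; rewrite mcoeff_msupp => nz.
have : comp_row (n := 0) (expZ e) p%:M 0 0 != 0.
  rewrite !mxE mulr1n /comp subr0 expZK; case: leZP => // - [] i.
  by rewrite !ffunE.
rewrite -VE (@comp_row_mul _ 0) mxE => sn0.
case: (pickP (fun j => comp_row (n := 1) (expZ e) V 0 j * sdiff 0 j 0 != 0)).
  move=> j; rewrite mulf_eq0 negb_or => /andP [nz1 nz2].
  by exists j => //; apply: comp_row_le nz1.
move=> none; case/eqP: sn0; apply: big1 => j _.
by have /negbFE /eqP := none j.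
Qed.

(** A cycle of a strand is made homogeneous by [hom_row], lifted over the polynomial ring, and the
    lift is cut down to its component of degree [a]. *)
Lemma resolves_degreewise I : resolves F I -> degreewise_exact I.
Proof.
move=> [ex1 ex0 imI].
have idI p q : I p -> I (q * p).
  move=> /imI [v vE]; apply/imI; exists (q *: v).
  by rewrite -scalemxAl vE scale_scalar_mx.
have ex n (V : 'rV[R]_(arank n.+1)) :
    V *m adiff n = 0 <-> exists W, V = W *m adiff n.+1.
  by case: n V => [|n] V; [apply: ex0 | apply: ex1].
have augI j : I (gaug F j 0).
  apply/imI; exists (delta_mx 0 j); rewrite -rowE.
  by apply/rowP => l; rewrite !mxE ord1 mulr1n.
split.
(* Into position 0: an augmentation entry with nonzero scalar is that scalar times a monomial, and
   dividing by the scalar puts the monomial in [I]. *)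
- case=> [|n] i j nz a /= ia; last exact: leZ_trans (sdiff_le nz) ia.
  exists (mnmZ (gdeg i)).
    by rewrite mnmZK //; apply: (sdiff_le nz).
  move: nz; rewrite mxE ord1 => nz.
  have hom := mgF.2 i; have := idI _ ((ev1 (gaug F i 0))^-1)%:MP (augI i).
  rewrite mul_mpolyC [X in I (_ *: X) -> _](homogeneousE hom) scalerA.
  by rewrite mulVf ?scale1r.
- move=> n; rewrite -map_mxM; suff -> : adiff n.+1 *m adiff n = 0.
    by rewrite map_mx0.
  apply/row_matrixP => i; rewrite row0 row_mul; apply/ex.
  by exists (row i 1%:M); rewrite -row_mul mul1mx.
case=> [|n] a v sv cv.
  have [v0|vn0] := eqVneq (v 0 0) 0.
    exists 0; first by move=> j; rewrite mxE eqxx.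
    by rewrite mul0mx; apply/rowP => j; rewrite ord1 v0 mxE.
  have [e ea /imI [V VE]] := sv 0 vn0.
  exists (v 0 0 *: comp_row (n := 1) (expZ e) V).
    move=> j; rewrite mxE => nz /=; apply: leZ_trans ea.
    have /comp_row_le // : comp_row (n := 1) (expZ e) V 0 j != 0.
    by apply: contraNneq nz => ->; rewrite mulr0.
  rewrite -scalemxAl -(@comp_row_mul _ 0) /= VE.
  apply/rowP => j; rewrite !mxE !ord1.
  rewrite /comp subr0 expZK mulr1n mcoeffX eqxx.
  case: leZP => [_|[]]; first by rewrite mulr1.
  by move=> i; rewrite !ffunE.
have : hom_row a v *m adiff n = 0 by rewrite hom_row_mul // cv hom_row0.
move=> /ex [W WE]; exists (comp_row a W); first by move=> j /comp_row_le.
by rewrite -comp_row_mul -WE comp_hom_row.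
Qed.

Lemma degreewise_resolves I :
  (forall p, I p <-> forall e, e \in msupp p -> in_ideal_degree I (expZ e)) ->
  degreewise_exact I -> resolves F I.
Proof.
move=> monI exI; have [supF dd _] := exI.
have ex n (V : 'rV[R]_(arank n.+1)) :
    V *m adiff n = 0 <-> exists W, V = W *m adiff n.+1.
  split=> [V0|[W ->]]; last by rewrite -mulmxA adiff_comp ?mulmx0.
  apply: lift_rows exI _ _ => a; first by move=> j /comp_row_le.
  by rewrite /= -comp_row_mul V0 comp_row0.
split=> [n V|V|p]; [exact: (ex n.+1) | exact: (ex 0%N) |].
rewrite monI; split=> [Ip|[V VE] e ep].
  have [||V ->] := @lift_rows I 0%N p%:M exI _ _; last by exists V.
    move=> a j; rewrite !mxE ord1 mulr1n /= /comp subr0 => nz.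
    move: nz; case: leZP => a0; rewrite ?eqxx // -mcoeff_msupp => /Ip.
    by rewrite mnmZK.
  by [].
have [j nzj je] := aug_msupp VE ep; exact: supF nzj _ je.
Qed.

Lemma resolves_msupp I : resolves F I -> forall p, I p <->
  forall e, e \in msupp p ->
    exists2 j : 'I_(grank F 0), ev1 (gaug F j 0) != 0 & leZ (gdeg j) (expZ e).
Proof.
move=> resF p; have [supF _ _] := resolves_degreewise resF.
have [_ _ imI] := resF; split=> [/imI [V VE] e ep|H].
  have [j nzj je] := aug_msupp VE ep; exists j => //.
  by move: nzj; rewrite mxE.
have monI e : e \in msupp p -> I 'X_[e].
  move=> /H [j nzj je].
  have [|e' /leZ_expZ e'e /imI [V VE]] := supF 0%N j 0 _ _ je.
    by rewrite mxE.
  apply/imI; exists ('X_[e - e'] *: V).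
  by rewrite -scalemxAl VE scale_scalar_mx -mpolyXD submK.
rewrite [p]mpolyE big_seq.
elim/big_rec: _ => [|e q /monI /imI [V VE] /imI [W WE]].
  apply/imI; exists 0; rewrite mul0mx; apply/matrixP => i j.
  by rewrite !mxE mul0rn.
apply/imI; exists ((p@_e)%:MP *: V + W).
rewrite mulmxDl -scalemxAl VE WE scale_scalar_mx -mul_mpolyC.
by apply/matrixP => i j; rewrite !mxE mulrnDl.
Qed.

End AugmentedComplex.

(** The matrices of a chain map have sizes varying with [n], hence choice along a dependent family,
    with the invariant [P] kept in a sigma type. *)
Lemma dependent_choice (T : nat -> Type) (P : forall n, T n -> Prop)
    (S : forall n, T n -> T n.+1 -> Prop) (x0 : T 0) :
  P 0 x0 -> (forall n x, P n x -> exists2 y, P n.+1 y & S n x y) ->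
  exists f : forall n, T n,
    [/\ f 0 = x0, forall n, P n (f n) & forall n, S n (f n) (f n.+1)].
Proof.
move=> P0 step.
have next n (x : {x | P n x}) : {y : {y | P n.+1 y} | S n (sval x) (sval y)}.
  apply: constructive_indefinite_description; case: x => x Px /=.
  by have [y Py Sy] := step n x Px; exists (exist _ y Py).
pose g := fix g n : {x | P n x} :=
  if n is n'.+1 then sval (next n' (g n')) else exist _ x0 P0.
exists (fun n => sval (g n)); split=> // n; first exact: svalP (g n).
exact: svalP (next n (g n)).
Qed.

(** * Comparison of resolutions *)

Section Comparison.
Variables (k : fieldType) (m : nat) (I : {mpoly k[m]} -> Prop).
Implicit Types E F : free_complex k m.

Notation Zm := {ffun 'I_m -> int}.

(** Scalar form of a degree-preserving map: such a matrix sends strands into strands in every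
    degree. *)
Definition supp_mx F E n n' (A : 'M[k]_(arank F n, arank E n')) :=
  forall i j, A i j != 0 -> forall a, present I i a -> present I j a.

Lemma sum_neq0 (J : finType) (f : J -> k) :
  \sum_j f j != 0 -> exists j, f j != 0.
Proof.
case: (pickP (fun j => f j != 0)) => [j nz _|none /eqP []]; first by exists j.
by apply: big1 => j _; have /negbFE /eqP := none j.
Qed.

Lemma supp_mxM F E G n n' n'' (A : 'M[k]_(arank F n, arank E n'))
    (B : 'M[k]_(arank E n', arank G n'')) :
  supp_mx A -> supp_mx B -> supp_mx (A *m B).
Proof.
move=> sA sB i j; rewrite mxE => /sum_neq0 [l nz] a ia.
have /andP [nA nB] : (A i l != 0) && (B l j != 0).
  by rewrite -negb_or -mulf_eq0.
exact/(sB l)/(sA i).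
Qed.

Lemma supp_mxD F E n n' (A B : 'M[k]_(arank F n, arank E n')) :
  supp_mx A -> supp_mx B -> supp_mx (A + B).
Proof.
move=> sA sB i j; rewrite mxE; have [->|nz _] := eqVneq (A i j) 0.
  by rewrite add0r; apply: sB.
exact: sA nz.
Qed.

Lemma supp_mxN F E n n' (A : 'M[k]_(arank F n, arank E n')) :
  supp_mx A -> supp_mx (- A).
Proof. by move=> sA i j; rewrite mxE oppr_eq0; apply: sA. Qed.

Lemma supp_mx1 F n : supp_mx (1%:M : 'M[k]_(arank F n, arank F n)).
Proof.
move=> i j; rewrite mxE; case: (i =P j) => [-> //|_].
by rewrite mulr0n eqxx.
Qed.

Lemma supp_mx0 F E n n' : supp_mx (0 : 'M[k]_(arank F n, arank E n')).
Proof. by move=> i j; rewrite mxE eqxx. Qed.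

Lemma row_in_mul F E n n' a v (A : 'M[k]_(arank F n, arank E n')) :
  row_in I a v -> supp_mx A -> row_in I a (v *m A).
Proof.
move=> sv sA j; rewrite mxE => /sum_neq0 [l nz].
have /andP [nv nA] : (v 0 l != 0) && (A l j != 0).
  by rewrite -negb_or -mulf_eq0.
exact: (sA l) nA _ (sv _ nv).
Qed.

(** Freeness: row [i] is lifted in the strand of the degree of basis element [i], so the lift is
    also present in all larger degrees. *)
Lemma lift_mx F E n n' (B : 'M[k]_(arank F n.+1, arank E n')) :
  degreewise_exact E I -> supp_mx B -> (forall i, scyc (row i B)) ->
  exists2 C : 'M[k]_(arank F n.+1, arank E n'.+1),
    supp_mx C & B = C *m sdiff E n'.
Proof.
move=> [_ _ ex] sB cB.
have rows i : exists w : 'rV[k]_(arank E n'.+1),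
    row_in I (gdeg (i : 'I_(grank F n))) w /\ row i B = w *m sdiff E n'.
  have [|w sw wE] := ex n' (gdeg (i : 'I_(grank F n))) (row i B) _ (cB i).
    by move=> j; rewrite mxE => /sB; apply; apply: leZ_refl.
  by exists w.
have [w wP] := fin_all_exists rows.
exists (\matrix_i w i).
  move=> i j; rewrite mxE => nz a /= ia.
  exact: leZ_trans ((wP i).1 j nz) ia.
by apply/row_matrixP => i; rewrite row_mul rowK (wP i).2.
Qed.

Lemma supp_sdiff F n : degreewise_exact F I -> supp_mx (sdiff F n).
Proof. by case=> sF _ _; apply: sF. Qed.

Definition chain_map F E (f : forall n, 'M[k]_(arank F n, arank E n)) :=
  [/\ f 0 = 1%:M, forall n, supp_mx (f n)
    & forall n, f n.+1 *m sdiff E n = sdiff F n *m f n].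

(** The identity in position 0 is lifted step by step; the invariant records that the rows to be
    lifted next are cycles. *)
Lemma exists_chain_map F E :
  degreewise_exact F I -> degreewise_exact E I -> exists f, @chain_map F E f.
Proof.
move=> exF exE.
pose P n (A : 'M[k]_(arank F n, arank E n)) :=
  supp_mx A /\ forall i, scyc (row i (sdiff F n *m A)).
pose S n (A : 'M[k]_(arank F n, arank E n))
    (B : 'M[k]_(arank F n.+1, arank E n.+1)) :=
  B *m sdiff E n = sdiff F n *m A.
have [||f [f0 fP fS]] := @dependent_choice _ P S 1%:M.
- by split=> // i j; rewrite mxE; case: (i =P j) => [-> //|]; rewrite ?eqxx.
- move=> n A [sA cA]; have sDA := supp_mxM (supp_sdiff (n := n) exF) sA.
  have [C sC CE] := lift_mx exE sDA cA; exists C; last by [].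
  split=> // i; rewrite /= row_mul -mulmxA -CE mulmxA -row_mul.
  by have [_ dd _] := exF; rewrite dd row0 mul0mx.
by exists f; split=> // n; case: (fP n).
Qed.

(** Only the two homotopy components around one position are carried along; the second becomes the
    first at the next step. As [f 0 = 0], the first one starts at zero. *)
Lemma null_homotopy F (f : forall n, 'M[k]_(arank F n, arank F n)) :
  degreewise_exact F I -> f 0 = 0 -> (forall n, supp_mx (f n)) ->
  (forall n, f n.+1 *m sdiff F n = sdiff F n *m f n) ->
  forall n, exists (h : 'M[k]_(arank F n, arank F n.+1))
    (h' : 'M[k]_(arank F n.+1, arank F n.+2)),
    [/\ supp_mx h, supp_mx h', n = 0%N -> h = 0
      & f n.+1 = h' *m sdiff F n.+1 + sdiff F n *m h].
Proof.
move=> exF f0 sf ff; have [_ dd _] := exF; elim=> [|n [h [h' [sh sh' _ fE]]]].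
  have [|h' sh' hE] := @lift_mx F F 0 1 (f 1%N) exF (sf _).
    by move=> i; rewrite /= -row_mul ff f0 mulmx0 row0.
  exists 0, h'; split=> //; first exact: supp_mx0.
  by rewrite mulmx0 addr0.
have [||h'' sh'' hE] := @lift_mx F F _ _ (f n.+2 - sdiff F n.+1 *m h') exF.
- apply: supp_mxD => //; apply: supp_mxN; apply: supp_mxM => //.
  exact: supp_sdiff.
- move=> i; rewrite /= -row_mul mulmxBl ff fE mulmxDr -!mulmxA.
  by rewrite addrAC subrr add0r mulmxA dd mul0mx row0.
by exists h', h''; split=> //; rewrite -hE subrK.
Qed.

Definition in_degree_part F n (a : Zm) (v : 'rV[k]_(grank F n)) :
  'rV[k]_(grank F n) := \row_j if gdeg j == a then v 0 j else 0.

Local Notation pr a v := (in_degree_part a v).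

Lemma prD F n a (v w : 'rV[k]_(grank F n)) : pr a (v + w) = pr a v + pr a w.
Proof. by apply/rowP => j; rewrite !mxE; case: ifP; rewrite ?addr0. Qed.

Lemma pr_in_degree F n a (v : 'rV[k]_(grank F n)) : in_degree a (pr a v).
Proof. by move=> j; rewrite mxE; case: (gdeg j =P a); rewrite ?eqxx. Qed.

Lemma pr_id F n a (v : 'rV[k]_(grank F n)) : in_degree a v -> pr a v = v.
Proof.
move=> dv; apply/rowP => j; rewrite mxE; case: eqP => // ne.
by apply/esym/eqP; apply/negPn/negP => /dv.
Qed.

Lemma in_degree_row_in F n a (v : 'rV[k]_(grank F n)) :
  in_degree a v -> row_in I (n := n.+1) a v.
Proof. by move=> dv j /dv <- /=; apply: leZ_refl. Qed.

(* The basis elements of degree strictly below [a] never map onto basis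
   elements of degree [a]. *)
Lemma pr_mul F E n n' a (v : 'rV[k]_(arank F n.+1))
    (A : 'M[k]_(arank F n.+1, arank E n'.+1)) :
  row_in I a v -> supp_mx A ->
  pr a (v *m A : 'rV_(grank E n')) = pr a ((pr a v : 'rV_(arank F n.+1)) *m A).
Proof.
move=> sv sA; apply/rowP => j; rewrite !mxE; case: eqP => // ja.
apply: eq_bigr => l _; rewrite !mxE; case: eqP => // la.
have [->|vl] := eqVneq (v 0 l) 0; first by rewrite mul0r.
have [->|Al] := eqVneq (A l j) 0; first by rewrite !mulr0.
case: la; apply: leZ_anti; first exact: sv vl.
by rewrite -ja; apply: (sA l j Al); apply: leZ_refl.
Qed.

(** A homogeneous entry has a constant term only between basis elements of equal degree, so the
    tensored differential is the part of the strand differential in degree exactly [a]. *)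
Lemma tdiffE F n a (v : 'rV[k]_(grank F n.+1)) :
  multigraded F -> in_degree a v ->
  v *m tdiff F n = pr a (v *m sdiff F n.+1).
Proof.
move=> mgF dv; apply/rowP => j; rewrite !mxE.
have term i : v 0 i * tdiff F n i j
    = if gdeg j == a then v 0 i * sdiff F n.+1 i j else 0.
  have [->|vi] := eqVneq (v 0 i) 0; first by rewrite !mul0r if_same.
  rewrite !mxE /= (homogeneous_const (mgF.1 _ i j)) subr_eq0 (dv i vi) eq_sym.
  by case: ifP; rewrite ?mulr0.
under eq_bigr do rewrite term.
by case: ifP => // _; rewrite big1.
Qed.

Lemma pr0 F n a : pr a (0 : 'rV[k]_(grank F n)) = 0.
Proof. by apply/rowP => j; rewrite !mxE if_same. Qed.

(** In the strand, the boundary of [v] lives in degrees strictly below [a], which never map to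
    degree [a]. For [n = 0] it lies in the augmentation position, which [pr_mul] does not cover;
    there [A = 0] is asked. *)
Lemma pr_cycle_mul F E n n' a (v : 'rV[k]_(grank F n))
    (A : 'M[k]_(arank F n, arank E n'.+1)) :
  multigraded F -> degreewise_exact F I -> in_degree a v -> tcycle v ->
  (n = 0%N -> A = 0) -> supp_mx A ->
  pr a (v *m sdiff F n *m A : 'rV_(grank E n')) = 0.
Proof.
move=> mgF exF; case: n v A => [|n] v A dv cv A0 sA.
  by rewrite A0 // mulmx0 pr0.
rewrite pr_mul //; last first.
  apply: row_in_mul (in_degree_row_in dv) _; exact: supp_sdiff.
by rewrite -(tdiffE (a := a)) // cv mul0mx pr0.
Qed.

Lemma tcycle_chain_map F E f n a (v : 'rV[k]_(grank F n)) :
  multigraded F -> multigraded E ->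
  degreewise_exact F I -> degreewise_exact E I -> @chain_map F E f ->
  in_degree a v -> tcycle v ->
  tcycle (pr a (v *m f n.+1 : 'rV_(grank E n))).
Proof.
move=> mgF mgE exF exE [_ sf ff] dv cv; case: n v dv cv => //= n v dv cv.
rewrite (tdiffE (a := a)) //; last exact: pr_in_degree.
rewrite -(@pr_mul E E n.+1 n a (v *m f n.+2) (sdiff E n.+1)).
- by rewrite -mulmxA ff mulmxA pr_cycle_mul.
- exact: row_in_mul (in_degree_row_in dv) _.
- exact: supp_sdiff.
Qed.

Lemma tensor_homology_comparison F E n a :
  multigraded F -> multigraded E ->
  degreewise_exact F I -> degreewise_exact E I ->
  tensor_homology_zero E n a -> tensor_homology_zero F n a.
Proof.
move=> mgF mgE exF exE zeroE v dv cv.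
have [f fmap] := exists_chain_map exF exE.
have [g gmap] := exists_chain_map exE exF.
have [f0 sf ff] := fmap; have [g0 sg gg] := gmap.
have [|||h [h' [sh sh' h0 hE]]] :=
  @null_homotopy F (fun n => 1%:M - f n *m g n) exF _ _ _ n.
- by rewrite f0 g0 mulmx1 subrr.
- move=> j; apply: supp_mxD; first exact: supp_mx1.
  by apply: supp_mxN; apply: supp_mxM.
- move=> j; rewrite mulmxBl mulmxBr mul1mx mulmx1 -mulmxA gg mulmxA ff.
  by rewrite mulmxA.
have sv := in_degree_row_in dv; have sF j := supp_sdiff (n := j) exF.
have sE j := supp_sdiff (n := j) exE.
have [|w [dw uE]] :=
  zeroE _ _ (tcycle_chain_map mgF mgE exF exE fmap dv cv).
  exact: pr_in_degree.
have sw := in_degree_row_in dw.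
pose wg : 'rV[k]_(arank F n.+2) := (w : 'rV_(arank E n.+2)) *m g n.+2.
(* [w] bounds the image of [v] in [E]. Its return under [g] plus the homotopy term bounds [v], up to
   parts of degree strictly below [a]. *)
pose x := wg + (v : 'rV_(arank F n.+1)) *m h'.
have sx : row_in I a x.
  move=> j; rewrite mxE; have [->|nz _] := eqVneq (wg 0 j) 0.
    by rewrite add0r; apply: (row_in_mul sv).
  exact: (row_in_mul sw (sg _)) nz.
exists (pr a (x : 'rV_(grank F n.+1))); split; first exact: pr_in_degree.
rewrite (tdiffE (a := a) mgF); last exact: pr_in_degree.
rewrite -(@pr_mul F F n.+1 n a x (sdiff F n.+1)) // -[LHS](pr_id dv).
have -> : v = v *m f n.+1 *m g n.+1 + v *m h' *m sdiff F n.+1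
              + v *m sdiff F n *m h.
  rewrite -[LHS](mulmx1 (v : 'rV_(arank F n.+1))).
  rewrite -[1%:M](subrK (f n.+1 *m g n.+1)) hE.
  by rewrite !mulmxDr !mulmxA addrC addrA.
rewrite prD pr_cycle_mul // addr0 mulmxDl !prD; congr (_ + _).
have -> : wg *m sdiff F n.+1 = w *m sdiff E n.+1 *m g n.+1.
  by rewrite -!mulmxA gg.
rewrite [LHS](pr_mul (E := F) (v := v *m f n.+1)) //; last first.
  exact: row_in_mul sv (sf _).
rewrite uE (tdiffE (a := a)) //.
rewrite -(pr_mul (E := F) (v := (w : 'rV_(arank E n.+2)) *m sdiff E n.+1)) //.
exact: row_in_mul sw (sE _).
Qed.

End Comparison.

(** * The Betti poset of a monomial ideal *)

Section MonomialIdeal.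
Variables (k : fieldType) (m : nat) (A : finType) (A0 : {set A}).
Variable (u : A -> 'X_{1..m}).

Notation R := {mpoly k[m]}.
Notation Zm := {ffun 'I_m -> int}.
Implicit Types (a : Zm) (S T : {set A}).

Definition generated_by (p : R) :=
  forall e, e \in msupp p -> exists2 x, x \in A0 & (u x <= e)%MM.

Definition lcmZ S : Zm := [ffun i => (\max_(x in S) u x i)%N%:Z].

Definition divisors_of a : {set A} :=
  [set x in A0 | [forall i, expZ (u x) i <= a i]].

(* The lcm-lattice of the ideal without its bottom element: an lcm is encoded
   by the set of all generators dividing it. *)
Definition lcm_lattice : {set {set A}} :=
  [set S | (S != set0) && (S == divisors_of (lcmZ S))].

Lemma lcmZ_le S a : S != set0 ->
  leZ (lcmZ S) a <-> forall x, x \in S -> leZ (expZ (u x)) a.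
Proof.
move=> /set0Pn [x0 x0S]; split=> [H x xS i|H i].
  apply: le_trans (H i); rewrite !ffunE lez_nat.
  exact: (leq_bigmax_cond (F := fun x => u x i)).
(* The generator [x0] forces [a] to be nonnegative; for empty [S] a negative [a] would break the
   equivalence. *)
have := H x0 x0S i; rewrite !ffunE; case ai: (a i) => [n|] // _.
by rewrite lez_nat; apply/bigmax_leqP => x /H /(_ i); rewrite ffunE ai lez_nat.
Qed.

Lemma divisors_ofP a x :
  x \in divisors_of a <-> x \in A0 /\ leZ (expZ (u x)) a.
Proof.
rewrite inE; split=> [/andP [xA /leZP] //|[xA xa]].
by rewrite xA; apply/leZP.
Qed.

Lemma lcm_latticeP S :
  S \in lcm_lattice <->
  S != set0 /\ forall x, x \in S <-> x \in A0 /\ leZ (expZ (u x)) (lcmZ S).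
Proof.
rewrite inE; split=> [/andP [S0 /eqP SE]|[S0 SP]].
  by split=> // x; rewrite {1}SE; apply: divisors_ofP.
rewrite S0; apply/eqP/setP => x.
by apply/idP/idP => [/SP|/divisors_ofP] xS; [apply/divisors_ofP | apply/SP].
Qed.

Lemma lcmZ_divisors a : divisors_of a != set0 -> leZ (lcmZ (divisors_of a)) a.
Proof. by move=> n0; apply/lcmZ_le => // x /divisors_ofP []. Qed.

Lemma divisors_in_lattice a :
  divisors_of a != set0 -> divisors_of a \in lcm_lattice.
Proof.
move=> n0; apply/lcm_latticeP; split=> // x; split=> [xd|[xA xle]].
  have [xA _] := (divisors_ofP a x).1 xd; split=> //.
  by apply: (lcmZ_le _ n0).1 => //; apply: leZ_refl.
by apply/divisors_ofP; split=> //; apply: leZ_trans xle (lcmZ_divisors n0).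
Qed.

(** A Galois connection: the lattice elements present in degree [a] are those below the single set
    [divisors_of a]. *)
Lemma lattice_sub_divisors S a : S \in lcm_lattice ->
  leZ (lcmZ S) a <-> S \subset divisors_of a.
Proof.
move=> /lcm_latticeP [S0 SP]; rewrite lcmZ_le //; split=> [H|/subsetP H x xS].
  by apply/subsetP => x xS; apply/divisors_ofP; have [] := (SP x).1 xS; auto.
by have /divisors_ofP [] := H x xS.
Qed.

Lemma lcmZ_mono S T : S \in lcm_lattice -> T \in lcm_lattice ->
  leZ (lcmZ S) (lcmZ T) <-> S \subset T.
Proof.
move=> SL TL; rewrite lattice_sub_divisors //.
by have := TL; rewrite inE => /andP [_ /eqP <-].
Qed.

Lemma lcmZ_inj S T : S \in lcm_lattice -> T \in lcm_lattice ->
  lcmZ S = lcmZ T -> S = T.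
Proof.
move=> SL TL e; apply/eqP; rewrite eqEsubset.
by apply/andP; split; apply/lcmZ_mono => //; rewrite e; apply: leZ_refl.
Qed.

(** * The resolution on the chains of the lcm-lattice *)

Notation lt := (fun y z : {set A} => y \proper z).
Notation L := lcm_lattice.
Notation chain n := {ffun n.-tuple {set A} -> k^o}.

Lemma proper_lt_trans : transitive lt.
Proof. by move=> S T U; apply: proper_trans. Qed.

Lemma proper_lt_irr : irreflexive lt.
Proof. by move=> S; rewrite properxx. Qed.

Definition top_vertex n (s : n.+1.-tuple {set A}) := tnth s ord_max.

(* A strand is the augmented complex of the chains of a poset with a largest
   element, hence exact.  In degree [lcmZ S], tensoring with [k] keeps the
   chains with largest element [S]; forgetting [S] turns them into the chains
   below [S], including the empty one. *)
Definition order_resolution : free_complex k m := {|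
  grank n := #|chains lt L n.+1|;
  gdeg n i := lcmZ (top_vertex (enum_val i));
  gdiff n := \matrix_(i, j) (incidence k (enum_val i) (enum_val j) *:
    'X_[mnmZ (lcmZ (top_vertex (enum_val i))
              - lcmZ (top_vertex (enum_val j)))]);
  gaug := \col_i 'X_[mnmZ (lcmZ (top_vertex (enum_val i)))] |}.

Notation E := order_resolution.

Lemma vertex_sub_top Q n (s : n.+1.-tuple {set A}) i :
  chain_pred lt Q s -> tnth s i \subset top_vertex s.
Proof.
move=> /(chain_predP proper_lt_trans) [_ mono].
have [->|ni] := eqVneq i ord_max; first exact: subxx.
apply: proper_sub; apply: mono; rewrite ltn_neqAle -ltnS ltn_ord andbT.
by apply: contraNneq ni => e; apply/eqP/val_inj.
Qed.

Lemma top_in_lattice n (i : 'I_#|chains lt L n.+1|) :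
  top_vertex (enum_val i) \in L.
Proof.
have := enum_valP i; rewrite inE => /(chain_predP proper_lt_trans) [inL _].
exact: inL.
Qed.

Lemma incidence_le n (i : 'I_#|chains lt L n.+2|) (j : 'I_#|chains lt L n.+1|) :
  incidence k (enum_val i) (enum_val j) != 0 ->
  leZ (lcmZ (top_vertex (enum_val j))) (lcmZ (top_vertex (enum_val i))).
Proof.
move=> nz; apply/lcmZ_mono; try exact: top_in_lattice.
have [l /eqP del] : exists l, del_vertex l (enum_val i) == enum_val j.
  apply/existsP; apply: contraNT nz; rewrite negb_exists => /forallP none.
  by rewrite /incidence big_pred0 // => l; apply/negbTE.
have := enum_valP i; rewrite inE -del /top_vertex tnth_mktuple => ch.
exact: vertex_sub_top ch.
Qed.

Lemma order_resolution_multigraded : multigraded E.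
Proof.
split=> [n i j|i] /=; rewrite mxE.
  have [->|nz] := eqVneq (incidence k (enum_val i) (enum_val j)) 0.
    by rewrite scale0r; apply: homogeneous0.
  by apply: homogeneousX; apply: subZ_ge0; apply: incidence_le.
rewrite -[X in homogeneous _ X]scale1r; apply: homogeneousX => l.
by rewrite !ffunE.
Qed.

Lemma sdiffS n : sdiff E n.+1 = bdmx k lt L n.+1.
Proof.
by apply/matrixP => i j; rewrite !mxE ev1Z ev1X mulr1.
Qed.

(** Position 0 has rank one by definition, while [bdmx] has a column for the empty chain. The
    entries agree but the index types do not, hence the free [j]. *)
Lemma sdiff0 n (V : 'M[k]_(n, arank E 1)) i j :
  (V *m sdiff E 0) i 0 = (V *m bdmx k lt L 0) i j.
Proof.
rewrite !mxE; apply: eq_bigr => l _; congr (_ * _); rewrite !mxE ev1X.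
rewrite /incidence big_ord1_cond ifT //.
by apply/eqP; rewrite [LHS]tuple0 [RHS]tuple0.
Qed.

Lemma nil_in_chains : [tuple] \in chains lt L 0.
Proof. by rewrite inE. Qed.

Definition nil_index : 'I_#|chains lt L 0| :=
  enum_rank_in nil_in_chains [tuple].

Lemma bdmx_bdmx n : bdmx k lt L n.+1 *m bdmx k lt L n = 0.
Proof.
apply/row_matrixP => i; rewrite row0 rowE mulmxA.
apply: (can_inj (@chain_of_rowK k _ lt L n)).
by rewrite !(chain_of_row_bd proper_lt_trans) bd_bd chain_of_row0.
Qed.

Lemma divisors_neq0 a :
  in_ideal_degree generated_by a <-> divisors_of a != set0.
Proof.
split=> [[e ea Ie]|/set0Pn [x /divisors_ofP [xA xa]]].
  have [|x xA /leZ_expZ xe] := Ie e; first by rewrite msuppX inE.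
  apply/set0Pn; exists x; apply/divisors_ofP; split=> //.
  exact: leZ_trans xe ea.
exists (u x) => // e; rewrite msuppX inE => /eqP ->.
by exists x => //; apply: lepm_refl.
Qed.

Lemma generated_by_monomials p : generated_by p <->
  forall e, e \in msupp p -> in_ideal_degree generated_by (expZ e).
Proof.
split=> H e ep.
  have [x xA xe] := H e ep; apply/divisors_neq0/set0Pn; exists x.
  by apply/divisors_ofP; split=> //; apply/leZ_expZ.
have /divisors_neq0 /set0Pn [x /divisors_ofP [xA xe]] := H e ep.
by exists x => //; apply/leZ_expZ.
Qed.

(** Its nonempty chains are the basis elements present in degree [a]; the empty chain stands for
    position 0. *)
Definition lattice_le a : {set {set A}} :=
  [set S in L | S \subset divisors_of a].

Lemma acyclic_lattice_le a :
  divisors_of a != set0 -> acyclic k lt (lattice_le a).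
Proof.
move=> n0.
apply: (acyclic_top proper_lt_trans proper_lt_irr (z := divisors_of a)).
  by rewrite inE subxx andbT; apply: divisors_in_lattice.
by move=> S; rewrite inE properEneq => /andP [_ ->] ->.
Qed.

Lemma supp_lattice_le n a (v : 'rV[k]_#|chains lt L n.+1|) :
  (forall i, v 0 i != 0 -> leZ (lcmZ (top_vertex (enum_val i))) a) ->
  supp lt (lattice_le a) (chain_of_row v).
Proof.
move=> sv t /chain_of_row_nz [i -> /sv].
rewrite lattice_sub_divisors; last exact: top_in_lattice.
have := enum_valP i; rewrite inE => ch top.
have /(chain_predP proper_lt_trans) [inL mono] := ch.
apply/(chain_predP proper_lt_trans); split=> // j; rewrite inE inL.
exact: subset_trans (vertex_sub_top j ch) top.
Qed.

Lemma lattice_le_sub a : lattice_le a \subset L.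
Proof. by apply/subsetP => S; rewrite inE => /andP []. Qed.

Lemma row_of_supp_in n a (b : chain n.+1) i : supp lt (lattice_le a) b ->
  row_of_chain lt L b 0 i != 0 -> leZ (lcmZ (top_vertex (enum_val i))) a.
Proof.
move=> sb; rewrite mxE => /sb /(chain_predP proper_lt_trans) [/(_ ord_max)].
rewrite inE => /andP [_ sub] _.
by apply/lattice_sub_divisors; first exact: top_in_lattice.
Qed.

Lemma order_resolution_exact : degreewise_exact E generated_by.
Proof.
split.
- case=> [|n] i j nz a /= ia; last first.
    apply: leZ_trans ia; apply: incidence_le; apply: contraNneq nz => e.
    by rewrite sdiffS mxE e.
  apply/divisors_neq0; have iL := top_in_lattice i.
  have /lcm_latticeP [/set0Pn [x xS] _] := iL.
  move: ia => /(lattice_sub_divisors _ iL) /subsetP /(_ _ xS) xd.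
  by apply/set0Pn; exists x.
- case=> [|n]; rewrite !sdiffS ?bdmx_bdmx //.
  apply/matrixP => i j; rewrite ord1 (sdiff0 _ _ nil_index) bdmx_bdmx.
  by rewrite !mxE.
case=> [|n] a v sv cv.
  have [v0|vn0] := eqVneq (v 0 0) 0.
    exists 0; first by move=> j; rewrite mxE eqxx.
    by rewrite mul0mx; apply/rowP => j; rewrite ord1 v0 mxE.
  have /divisors_neq0 d0 := sv 0 vn0.
  (* The scalar [v 0 0] becomes a chain on the empty tuple. *)
  have [||b sb bE] := acyclic_lattice_le d0 (n := 0) (c := [ffun=> v 0 0]).
  - exact: supp_chain0.
  - by [].
  exists (row_of_chain lt L b) => [j|]; first exact: row_of_supp_in.
  apply/rowP => j; rewrite ord1 (sdiff0 _ _ nil_index).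
  rewrite -row_bd; last exact: supp_sub (lattice_le_sub a) sb.
  by rewrite -bE mxE ffunE.
have [v0|/eqP vn0] := eqVneq v 0.
  exists 0; first by move=> j; rewrite mxE eqxx.
  by rewrite v0 mul0mx.
have d0 : divisors_of a != set0.
  have /rV0Pn [j nz] : v != 0 by apply/eqP.
  have /lcm_latticeP [/set0Pn [x xS] _] := top_in_lattice j.
  have /(lattice_sub_divisors _ (top_in_lattice j)) := sv j nz.
  move=> /subsetP /(_ _ xS) xd.
  by apply/set0Pn; exists x.
have sc := supp_lattice_le (sv : forall i, _ -> leZ _ a).
have cc : cyc (chain_of_row (v : 'rV_#|chains lt L n.+1|)).
  case: n v sv cv {vn0} sc => [|n] v sv cv sc.
    rewrite /= -(chain_of_row_bd proper_lt_trans) -[RHS](chain_of_row0 k lt L).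
    congr chain_of_row; apply/rowP => j.
    by rewrite -sdiff0 cv !mxE.
  rewrite /= -(chain_of_row_bd proper_lt_trans) -sdiffS [X in chain_of_row X]cv.
  exact: chain_of_row0.
have [b sb bE] := acyclic_lattice_le d0 sc cc.
exists (row_of_chain lt L b) => [j|]; first exact: row_of_supp_in.
rewrite sdiffS -row_bd; last exact: supp_sub (lattice_le_sub a) sb.
by rewrite -bE chain_of_rowK.
Qed.

Lemma order_resolution_resolves : resolves E generated_by.
Proof.
apply: degreewise_resolves order_resolution_multigraded _ _ _.
  exact: generated_by_monomials.
exact: order_resolution_exact.
Qed.

(** [lcmZ] is injective on the lattice, so the basis elements of degree exactly [lcmZ S] are the
    chains ending in [S]. *)
Lemma chain_of_degree_part S n (w : 'rV[k]_(grank E n)) : S \in L ->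
  chain_of_row (in_degree_part (lcmZ S) w : 'rV_#|chains lt L n.+1|)
  = cone S (slice S (chain_of_row w)).
Proof.
move=> SL; apply/ffunP => s; have [z [t ->]] := rcons_vertexP s.
rewrite cone_rcons.
have [ch|nch] := boolP (rcons_vertex z t \in chains lt L n.+1).
  rewrite -(enum_rankK_in ch ch) chain_of_rowE mxE.
  have <- : chain_of_row w (rcons_vertex z t)
             = w 0 (enum_rank_in ch (rcons_vertex z t)).
    by rewrite -[in LHS](enum_rankK_in ch ch) chain_of_rowE.
  rewrite /= enum_rankK_in // /top_vertex tnth_rcons_last.
  have zL : z \in L.
    by move: ch; rewrite inE (chain_pred_rcons proper_lt_trans) => /andP [].
  case: (z =P S) => [->|zS]; first by rewrite eqxx sliceE.
  by case: eqP => // e; case: zS; apply: lcmZ_inj.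
have zero (v : 'rV[k]_#|chains lt L n.+1|) :
    chain_of_row v (rcons_vertex z t) = 0.
  by apply/eqP; apply: contraNT nch => /supp_chain_of_row; rewrite inE.
rewrite zero; case: (z =P S) => // zS.
by rewrite sliceE -zS zero.
Qed.

Lemma chain_of_homogeneous S n (v : 'rV[k]_(grank E n)) : S \in L ->
  in_degree (lcmZ S) v -> chain_of_row v = cone S (slice S (chain_of_row v)).
Proof. by move=> SL dv; rewrite -chain_of_degree_part // pr_id. Qed.

(** In the boundary of a cone over [S], the term deleting [S] ends in a smaller lcm, and tensoring
    kills it. *)
Lemma chain_of_tdiff S n (v : 'rV[k]_(grank E n.+1)) : S \in L ->
  in_degree (lcmZ S) v ->
  chain_of_row (v *m tdiff E n : 'rV_#|chains lt L n.+1|)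
  = cone S (bd (slice S (chain_of_row v))).
Proof.
move=> SL dv; rewrite (tdiffE order_resolution_multigraded dv).
rewrite chain_of_degree_part // sdiffS (chain_of_row_bd proper_lt_trans).
rewrite {1}(chain_of_homogeneous SL dv) bd_coneS linearD /=.
rewrite slice_cone eqxx linearZ /=.
suff -> : slice S (slice S (chain_of_row v)) = 0 by rewrite scaler0 addr0.
apply: (slice_notin proper_lt_trans (Q := below lt L S)).
  by rewrite inE properxx andbF.
by apply: (supp_slice proper_lt_trans); apply: supp_chain_of_row.
Qed.

Lemma tcycle_slice S n (v : 'rV[k]_(grank E n)) : S \in L ->
  in_degree (lcmZ S) v -> tcycle v <-> cyc (slice S (chain_of_row v)).
Proof.
move=> SL; case: n v => //= n v dv.
have E1 := chain_of_tdiff SL dv.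
split=> [v0|b0].
  move: E1; rewrite v0 chain_of_row0 => /(congr1 (@slice k _ S _)).
  by rewrite linear0 slice_cone eqxx.
apply: (can_inj (@chain_of_rowK k _ lt L n.+1)).
by rewrite E1 b0 linear0 chain_of_row0.
Qed.

(** [cone S] and [slice S] are inverse to each other. Position [n] holds chains of [n + 1] vertices,
    so removing [S] leaves the [n] vertices counted by [hzero]. *)
Lemma order_resolution_homology S n : S \in L ->
  tensor_homology_zero E n (lcmZ S) <-> hzero k lt (below lt L S) n.
Proof.
move=> SL.
have deg j (c : chain j) : supp lt (below lt L S) c ->
    in_degree (F := E) (n := j) (lcmZ S) (row_of_chain lt L (cone S c)).
  move=> sc i; rewrite mxE; have [z [t e]] := rcons_vertexP (enum_val i).
  rewrite /= e cone_rcons /top_vertex tnth_rcons_last.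
  by case: (z =P S) => [->|_]; rewrite ?eqxx.
have rowK j (c : chain j) : supp lt (below lt L S) c ->
    chain_of_row (row_of_chain lt L (cone S c)) = cone S c.
  move=> sc; apply: row_of_chainK; apply: supp_cone => //.
  exact: proper_lt_trans.
split=> [H c sc cc|H v dv cv].
  have [||w [dw vE]] := H (row_of_chain lt L (cone S c)); first exact: deg.
    apply/(tcycle_slice SL); first exact: (deg _ _ sc).
    by rewrite rowK // slice_cone eqxx.
  exists (slice S (chain_of_row w)).
    apply: (supp_slice proper_lt_trans); exact: supp_chain_of_row.
  have := congr1
    (fun x : 'rV_#|chains lt L n.+1| => slice S (chain_of_row x)) vE.
  by rewrite rowK // (chain_of_tdiff SL dw) !slice_cone eqxx.
have [||b sb bE] := H (slice S (chain_of_row v)).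
- apply: (supp_slice proper_lt_trans); exact: supp_chain_of_row.
- exact/(tcycle_slice SL dv).
exists (row_of_chain lt L (cone S b)); split; first exact: deg.
apply: (can_inj (@chain_of_rowK k _ lt L n.+1)).
rewrite (chain_of_tdiff SL (deg _ _ sb)).
by rewrite rowK // slice_cone eqxx -bE -chain_of_homogeneous.
Qed.

(** Any resolution may witness nonzero Tor; comparison transfers it to the order resolution, which
    has no basis element in a degree that is not an lcm. *)
Lemma betti_posetP (I : R -> Prop) a : (forall p, I p <-> generated_by p) ->
  in_betti_poset I a <->
  exists S, [/\ S \in L, a = lcmZ S
    & exists n, ~ reduced_homology_zero k lt (below lt L S) n].
Proof.
move=> Igen; have EI : resolves E I.
  have [e1 e2 e3] := order_resolution_resolves; split=> // p.
  by rewrite Igen e3.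
have mgE := order_resolution_multigraded.
split=> [[n [F [mgF resF nz]]]|[S [SL aE [n nz]]]]; last first.
  exists n, E; split=> // zE; apply: nz.
  apply/(reduced_homology_zeroP k proper_lt_trans).
  by apply/order_resolution_homology; rewrite -?aE.
have nzE : ~ tensor_homology_zero E n a.
  move=> zE; apply: nz; apply: (tensor_homology_comparison mgF mgE) zE.
    exact: resolves_degreewise resF.
  exact: resolves_degreewise EI.
case: (pickP [pred S | (S \in L) && (a == lcmZ S)])
  => [S /andP [SL /eqP aE]|none].
  exists S; split=> //; exists n => z; apply: nzE; rewrite aE.
  apply/order_resolution_homology => //.
  exact/(reduced_homology_zeroP k proper_lt_trans).
case: nzE => v dv _; exists 0; split; first by move=> j; rewrite mxE eqxx.
rewrite mul0mx; apply/rowP => i; rewrite mxE; apply/eqP/negPn/negP => /dv aE.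
by have := none (top_vertex (enum_val i)); rewrite /= top_in_lattice -aE eqxx.
Qed.

End MonomialIdeal.

(** The empty face is a cycle bounding nothing. This puts minimal lcms into the Betti poset. *)
Lemma nacyclic_set0 (k : fieldType) (T : finType) (lt : rel T) :
  transitive lt -> ~ reduced_homology_zero k lt set0 0.
Proof.
move=> tr /(reduced_homology_zeroP k tr) H.
have [||b sb bE] := H [ffun=> 1]; [exact: supp_chain0 | by [] |].
move/ffunP: bE => /(_ [tuple]).
rewrite (supp_empty tr sb) linear0 !ffunE => /eqP.
by rewrite oner_eq0.
Qed.

Lemma generated_by_ideal (k : fieldType) m (A : finType) (A0 : {set A})
    (u : A -> 'X_{1..m}) : monomial_ideal (@generated_by k m A A0 u).
Proof.
exists (fun e => exists2 x, x \in A0 & e = u x) => p; split=> [gp|[s [sG ->]]].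
  rewrite [p]mpolyE; move: (msupp p) (gp : {in msupp p, forall e, _}).
  elim=> [|e l IH] gl; first by exists [::]; split=> //; rewrite !big_nil.
  have [|s [sG sE]] := IH.
    by move=> e' e'l; apply: gl; rewrite inE e'l orbT.
  have [x xA xe] := gl e (mem_head e l).
  exists ((p@_e *: 'X_[e - u x], u x) :: s); split.
    by move=> v; rewrite inE => /predU1P [->|/sG //]; exists x.
  by rewrite !big_cons sE /= -scalerAl -mpolyXD submK.
elim: s sG => [|v s IH] sG e; first by rewrite big_nil msupp0.
rewrite big_cons => /msuppD_le; rewrite mem_cat => /orP [|]; last first.
  by apply: IH => w ws; apply: sG; rewrite inE ws orbT.
have [x xA ->] := sG v (mem_head v s).
rewrite (perm_mem (msuppMX _ _)) => /mapP [e' _ ->]; exists x => //.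
exact: lem_addr.
Qed.

(** Gives an ideal known only through a resolution a finite family of monomial generators, to which
    the lcm-lattice applies. *)
Lemma ideal_of_resolution (k : fieldType) m (F : free_complex k m) I :
  multigraded F -> resolves F I -> forall p, I p <->
  generated_by [set j | ev1 (gaug F j 0) != 0]
               (fun j : 'I_(grank F 0) => mnmZ (gdeg j)) p.
Proof.
move=> mgF resF p; rewrite (resolves_msupp mgF resF).
have ge0 (j : 'I_(grank F 0)) : ev1 (gaug F j 0) != 0 -> leZ 0 (gdeg j).
  exact: homogeneous_ev1_neq0 (mgF.2 j).
split=> H e /H [j nzj je]; exists j; rewrite ?inE // in nzj *.
  by apply/leZ_expZ; rewrite mnmZK //; apply: ge0.
by move/leZ_expZ: je; rewrite mnmZK //; apply: ge0.
Qed.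

(** * Atomic posets *)

Section AtomicPoset.
Variables (d : Order.disp_t) (P : finPOrderType d) (k : fieldType).

Notation lt := (fun y z : {set P} => y \proper z).
Notation min_elts := (min_elts P).
Notation sigma_image := (sigma_image P).
Notation meets := (meets P).

(** Stands in for the meets other than [hat0]: the two agree when [hat0] is empty, and
    [punctured_condition] settles the other case. *)
Definition nonempty_meets : {set {set P}} := [set y in meets | y != set0].

Notation N := nonempty_meets.

Lemma min_eltsP (a : P) :
  a \in min_elts <-> forall y : P, (y <= a)%O -> y = a.
Proof.
rewrite inE; split=> [/forallP H y ya|H].
  by apply/eqP; have /implyP := H y; apply.
by apply/forallP => y; apply/implyP => /H ->.
Qed.

Lemma ex_min_elt (x : P) : exists2 a, a \in min_elts & (a <= x)%O.
Proof.
have := @arg_minnP P x (fun a => (a <= x)%O)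
          (fun a => #|[set z : P | (z <= a)%O]|) (lexx x).
case=> a ax amin.
exists a => //; apply/min_eltsP => y ya; apply/eqP; rewrite -[_ == _]negbK.
apply/negP => ne; have := amin y (le_trans ya ax); rewrite leqNgt.
case/negP; apply: proper_card; apply/properP; split.
  by apply/subsetP => z; rewrite !inE => /le_trans ->.
by exists a; rewrite inE ?lexx // lt_geF // lt_neqAle ne.
Qed.

Lemma atoms_belowE (x a : P) :
  (a \in atoms_below x) = (a \in min_elts) && (a <= x)%O.
Proof. by rewrite inE. Qed.

Lemma meetsP (S : {set P}) : reflect
  (exists X : {set P}, forall a,
     a \in S <-> a \in min_elts /\ forall x, x \in X -> (a <= x)%O)
  (S \in meets).
Proof.
apply: (iffP imsetP) => [[X _ ->]|[X SX]]; exists X => //.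
  move=> a; rewrite in_setI; split=> [/andP [am /bigcapP aX]|[am aX]].
    by split=> // x /aX; rewrite atoms_belowE => /andP [].
  by rewrite am; apply/bigcapP => x /aX ax; rewrite atoms_belowE am.
apply/setP => a; rewrite in_setI; apply/idP/andP.
  move=> /SX [am aX]; split=> //; apply/bigcapP => x /aX ax.
  by rewrite atoms_belowE am.
move=> [am /bigcapP aX]; apply/SX; split=> // x /aX.
by rewrite atoms_belowE => /andP [].
Qed.

Lemma atoms_below_meets (x : P) : atoms_below x \in meets.
Proof.
apply/meetsP; exists [set x] => a; rewrite atoms_belowE.
split=> [/andP [am ax]|[-> aX]]; last by apply: aX; rewrite inE.
by split=> // y; rewrite inE => /eqP ->.
Qed.

Lemma atoms_below_neq0 (x : P) : atoms_below x != set0.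
Proof.
have [a am ax] := ex_min_elt x; apply/set0Pn; exists a.
by rewrite atoms_belowE am.
Qed.

Lemma sigma_image_nonempty_meets (S : {set P}) : S \in sigma_image -> S \in N.
Proof.
case/imsetP => x _ ->.
by rewrite inE atoms_below_meets atoms_below_neq0.
Qed.

Lemma atoms_below_mono (x y : P) :
  (x <= y)%O -> atoms_below x \subset atoms_below y.
Proof.
move=> xy; apply/subsetP => a; rewrite !atoms_belowE => /andP [-> ax].
exact: le_trans xy.
Qed.

(* [hat0] is nonempty only if [P] has a least element and hence a single
   atom. *)
Lemma punctured_condition :
  (forall x, x \in meets -> x != hat0 P ->
     (x \notin sigma_image <->
      forall n, reduced_homology_zero k lt (punctured_below x) n))
  <->
  (forall x, x \in N ->
     (x \notin sigma_image <->
      forall n, reduced_homology_zero k lt (below lt N x) n)).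
Proof.
have [hat0M hat0min] := @hat0_least d P.
have [h0|/set0Pn [a ah]] := eqVneq (hat0 P) set0.
  have E x : punctured_below x = below lt N x.
    apply/setP => y; rewrite !inE h0.
    by case: (y \in _); case: (y == set0); case: (y \proper x).
  split=> H x; first by rewrite inE -E -h0 => /andP [xM x0]; apply: H.
  by move=> xM x0; rewrite E; apply: H; rewrite inE xM -h0.
have am : a \in min_elts by have /meetsP [X /(_ a) [/(_ ah) []]] := hat0M.
have least x : (a <= x)%O.
  have /subsetP /(_ a ah) := hat0min _ (atoms_below_meets x).
  by rewrite atoms_belowE => /andP [].
have meets1 S : S \in meets -> S = [set a].
  move=> SM; apply/eqP; rewrite eqEsubset sub1set.
  apply/andP; split; last first.
    by apply: (subsetP (hat0min _ SM)).
  have /meetsP [X SX] := SM.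
  apply/subsetP => b /SX [/min_eltsP bm _]; rewrite inE.
  by rewrite (bm a (least b)).
(* Here [[set a]] is the only meet: no meet differs from [hat0], while [[set a]] is the image of [a]
   and has an empty, hence not acyclic, lower interval. *)
split=> H x; first last.
  by move=> xM /negP []; rewrite (meets1 x xM) (meets1 _ hat0M).
rewrite inE => /andP [/meets1 -> _]; split=> [/negP []|].
  apply/imsetP; exists a => //; apply/esym/meets1; exact: atoms_below_meets.
move=> /(_ 0%N) H0; exfalso; have := H0.
suff -> : below lt N [set a] = set0.
  by apply: nacyclic_set0; apply: proper_lt_trans.
apply/setP => y; rewrite !inE; apply/negP => /andP [/andP [/meets1 ->]].
by rewrite properxx.
Qed.

(** * From the homological condition to an ideal *)

Section IdealOfPoset.

(* The lcm of a set of atoms then depends only on the elements of [P] above all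
   of them, that is, on the smallest meet containing the set. *)
Definition poset_mnm (a : P) : 'X_{1..#|P|} :=
  [multinom (~~ (a <= enum_val i)%O : nat) | i < #|P|].

Notation L := (lcm_lattice min_elts poset_mnm).

(** Exponents are 0 or 1, and the variable of [p] occurs in the lcm of [S] exactly when some element
    of [S] is not below [p]. *)
Lemma poset_mnm_le (a : P) (S : {set P}) :
  leZ (expZ (poset_mnm a)) (lcmZ poset_mnm S) <->
  forall p : P, (forall s, s \in S -> (s <= p)%O) -> (a <= p)%O.
Proof.
split=> H.
  move=> p Sp; have := H (enum_rank p); rewrite !ffunE mnmE enum_rankK.
  rewrite lez_nat big1 ?leqn0 ?eqb0 ?negbK // => s sS.
  by rewrite mnmE enum_rankK Sp.
move=> i; rewrite !ffunE mnmE lez_nat.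
have [//|nai] := boolP (a <= enum_val i)%O.
have [s /andP [sS ns]] : exists s, (s \in S) && ~~ (s <= enum_val i)%O.
  apply/existsP; apply: contraNT nai; rewrite negb_exists => /forallP none.
  apply: H => s sS; have := none s; rewrite sS /=; exact: negbNE.
apply: leq_trans (leq_bigmax_cond (F := fun x => poset_mnm x i) _ sS).
by rewrite mnmE ns.
Qed.

Lemma poset_lcm_lattice : L = N.
Proof.
apply/setP => S; rewrite [in RHS]inE andbC.
apply/idP/idP => [/lcm_latticeP [-> SL]|/andP [S0 /meetsP [X SX]]] /=.
  (* The family of all upper bounds of [S]: by [poset_mnm_le], the generators dividing the lcm are
     the atoms below all of them. *)
  apply/meetsP; exists [set p | [forall s in S, (s <= p)%O]] => a.
  split=> [aS|[am aX]].
    have [am _] := (SL a).1 aS; split=> // p; rewrite inE => /forall_inP; exact.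
  apply/SL; split=> //; apply/poset_mnm_le => p Sp; apply: aX.
  by rewrite inE; apply/forall_inP.
apply/lcm_latticeP; split=> // a; split=> [aS|[am /poset_mnm_le H]].
  by have [am _] := (SX a).1 aS; split=> //; apply/poset_mnm_le => p; apply.
by apply/SX; split=> // x xX; apply: H => s /SX [_]; apply.
Qed.

(** Atomicity recovers [x <= y] from the inclusion of atoms, since [x] is the least upper bound of
    its own. *)
Lemma poset_ideal_betti (hP : atomic P) :
  (forall S, S \in N -> (S \notin sigma_image <->
     forall n, reduced_homology_zero k lt (below lt N S) n)) ->
  isomorphic_to_betti_poset P (@generated_by k _ _ min_elts poset_mnm).
Proof.
move=> H; exists (fun x => lcmZ poset_mnm (atoms_below x)).
have xN x : atoms_below x \in N.
  by apply: sigma_image_nonempty_meets; apply: imset_f.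
split=> [a|x y].
  rewrite (betti_posetP (A0 := min_elts) (u := poset_mnm)) // poset_lcm_lattice.
  split=> [[S [SN -> [n nz]]]|[x ->]].
    have /imsetP [x _ ->] : S \in sigma_image; last by exists x.
    by apply/negPn/negP => /(H S SN) /(_ n).
  exists (atoms_below x); split=> //; apply: not_all_ex_not => z.
  by have /negP [] := (H _ (xN x)).2 z; apply: imset_f.
split=> [xy|xy].
  apply/(lcmZ_mono (A0 := min_elts)); rewrite ?poset_lcm_lattice //.
  exact: atoms_below_mono.
have /subsetP sub : atoms_below x \subset atoms_below y.
  by apply/(lcmZ_mono (A0 := min_elts) (u := poset_mnm));
    rewrite ?poset_lcm_lattice.
apply: (hP x).2 => a /sub; rewrite atoms_belowE => /andP [] //.
Qed.

End IdealOfPoset.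

(** * From a Betti poset to the homological condition *)

Section PosetOfIdeal.
Variables (m : nat) (I : {mpoly k[m]} -> Prop) (f : P -> {ffun 'I_m -> int}).
Hypothesis f_betti : forall a, in_betti_poset I a <-> exists x, a = f x.
Hypothesis f_mono : forall x y : P, (x <= y)%O <-> leZ (f x) (f y).

Let u (x : P) := mnmZ (f x).

(** A minimal lcm has an empty lower interval, so it is a Betti degree; hence each given generator
    is a multiple of that of a minimal element of [P]. Conversely each [f x] is an lcm, hence the
    degree of a multiple of a generator. *)
Lemma generated_by_min_elts (A : finType) (A0 : {set A}) (v : A -> 'X_{1..m}) :
  (forall p, I p <-> generated_by A0 v p) ->
  (forall x, leZ 0 (f x)) /\ forall p, I p <-> generated_by min_elts u p.
Proof.
move=> gen; have fE x : exists2 S, S \in lcm_lattice A0 v & f x = lcmZ v S.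
  have [|S [SL -> _]] := (betti_posetP (f x) gen).1; last by exists S.
  by apply/f_betti; exists x.
have f0 x : leZ 0 (f x).
  by have [S _ ->] := fE x; move=> i; rewrite !ffunE.
split=> // p; rewrite gen; split=> H e /H [x xA xe].
  have [S minS Sx] : exists2 S : {set A}, minset [pred S in lcm_lattice A0 v] S
      & S \subset divisors_of A0 v (expZ (v x)).
    have xd : divisors_of A0 v (expZ (v x)) \in lcm_lattice A0 v.
      apply: divisors_in_lattice; apply/set0Pn; exists x; apply/divisors_ofP.
      by split=> //; apply: leZ_refl.
    have [S minS sub] :=
      minset_exists (xd : [pred S in lcm_lattice A0 v] _).
    by exists S.
  have [/= SL Smin] := minsetP minS.
  have [y fy] : exists y, lcmZ v S = f y.
    apply/f_betti/(betti_posetP _ gen); exists S; split=> //; exists 0%N.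
    suff -> : below (fun y z : {set A} => y \proper z)
                    (lcm_lattice A0 v) S = set0.
      by apply: nacyclic_set0; apply: proper_lt_trans.
    apply/setP => T; rewrite [RHS]inE inE; apply/negP => /andP [TL ST].
    by have TS := Smin T TL (proper_sub ST); rewrite TS properxx in ST.
  have [z zm zy] := ex_min_elt y; exists z => //; apply/leZ_expZ.
  rewrite mnmZK //; apply: leZ_trans ((f_mono _ _).1 zy) _; rewrite -fy.
  by apply: leZ_trans ((lattice_sub_divisors _ SL).2 Sx) _; apply/leZ_expZ.
have [S SL fx] := fE x.
have [S0 SP] := (lcm_latticeP _ _ S).1 SL.
have [y yS] := set0Pn _ S0; have [yA ylcm] := (SP y).1 yS; exists y => //.
apply/leZ_expZ; apply: leZ_trans ylcm _; rewrite -fx -(mnmZK (f0 x)).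
exact/leZ_expZ.
Qed.

Hypothesis f_ge0 : forall x, leZ 0 (f x).
Hypothesis gen : forall p, I p <-> generated_by min_elts u p.

Notation L := (lcm_lattice min_elts u).

Lemma lcm_atoms_below S x : S \in L -> f x = lcmZ u S -> S = atoms_below x.
Proof.
move=> /lcm_latticeP [_ SP] fx; apply/setP => a; rewrite atoms_belowE.
apply/idP/andP => [/SP [am]|[am ax]].
  by rewrite -fx mnmZK // => /f_mono.
by apply/SP; split=> //; rewrite -fx mnmZK //; apply/f_mono.
Qed.

Lemma sigma_imageP S : S \in sigma_image <->
  S \in L /\ exists n, ~ reduced_homology_zero k lt (below lt L S) n.
Proof.
split=> [/imsetP [x _ ->]|[SL nz]].
  have [|T [TL fT nz]] := (betti_posetP (f x) gen).1.
    by apply/f_betti; exists x.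
  by rewrite -(lcm_atoms_below TL fT).
have [|x fx] := (f_betti (lcmZ u S)).1.
  by apply/(betti_posetP _ gen); exists S.
by apply/imsetP; exists x => //; apply: lcm_atoms_below.
Qed.

(** If the generator of [a] divides the lcm of [S], then [f a] is below [f x] for each upper bound
    [x] of [S], so [a] belongs to the meet. *)
Lemma nonempty_meets_sub_lattice : N \subset L.
Proof.
apply/subsetP => S; rewrite inE => /andP [/meetsP [X SX] S0].
apply/lcm_latticeP; split=> // a; split=> [aS|[am ale]].
  have [am _] := (SX a).1 aS; split=> //.
  by apply: (lcmZ_le _ _ S0).1 => //; apply: leZ_refl.
apply/SX; split=> // x xX; apply/f_mono; rewrite -(mnmZK (f_ge0 a)).
apply: leZ_trans ale _; apply/lcmZ_le => // s /SX [_ /(_ x xX)] sx.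
by rewrite mnmZK //; apply/f_mono.
Qed.

(** Lattice elements outside [N] are not in [sigma_image], so their lower intervals are acyclic and
    [acyclic_ideal] deletes them below [S]. *)
Lemma betti_poset_condition S : S \in N ->
  (S \notin sigma_image <->
   forall n, reduced_homology_zero k lt (below lt N S) n).
Proof.
move=> SN; have SL := subsetP nonempty_meets_sub_lattice _ SN.
have acL T : T \in L -> T \notin sigma_image <-> acyclic k lt (below lt L T).
  move=> TL; split=> [/negP nT n|ac].
    apply/(reduced_homology_zeroP k (@proper_lt_trans P)); apply: NNPP => nz.
    by apply: nT; apply/sigma_imageP; split=> //; exists n.
  apply/negP => /sigma_imageP [_ [n []]].
  by apply/(reduced_homology_zeroP k (@proper_lt_trans P)).
have -> : below lt N S = below lt L S :&: N.
  apply/setP => T; rewrite !inE; have [TN|] := boolP (T \in N).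
    have := subsetP nonempty_meets_sub_lattice _ TN; move: TN; rewrite !inE.
    by move=> -> ->; rewrite andbT.
  by rewrite inE => /negbTE ->; rewrite andbF.
have acN := acyclic_ideal (k := k) (@proper_lt_trans P) (@proper_lt_irr P)
  (L := L) (N := N) (D := below lt L S).
rewrite (acL S SL) acN.
- by split=> H n; apply/(reduced_homology_zeroP k (@proper_lt_trans P)).
- move=> T TL TN; apply/acL => //; apply: contraNN TN.
  exact: sigma_image_nonempty_meets.
- exact: (order_ideal_below (@proper_lt_trans P)).
Qed.

End PosetOfIdeal.

End AtomicPoset.

Theorem theorem6p4 (d : Order.disp_t) (P : finPOrderType d) (k : fieldType)
    (hP : atomic P) :
  (exists (m : nat) (I : {mpoly k[m]} -> Prop),
     monomial_ideal I /\ isomorphic_to_betti_poset P I)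
  <->
  (forall x : {set P}, x \in meets P -> x != hat0 P ->
     (x \notin sigma_image P <->
      forall n : nat,
        reduced_homology_zero k (fun y z : {set P} => y \proper z)
          (punctured_below x) n)).
Proof.
rewrite punctured_condition; split=> [[m [I [_ [f [fB fM]]]]]|H]; last first.
  exists #|P|, (@generated_by k _ _ (min_elts P) (@poset_mnm _ P)).
  by split; [apply: generated_by_ideal | apply: poset_ideal_betti].
(* A nonempty [S] supplies an element of [P]; nonzero Tor in its Betti degree comes with a
   multigraded resolution of [I], and so with finitely many monomial generators. *)
move=> S SN; have [x _] : exists x, x \in S.
  by apply/set0Pn; move: SN; rewrite inE => /andP [].
have [n [F [mgF resF _]]] : in_betti_poset I (f x) by apply/fB; exists x.
have [f0 gen] := generated_by_min_elts fB fM (ideal_of_resolution mgF resF).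
exact: (betti_poset_condition fB fM f0 gen).
Qed.
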